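(* For each simple root $\alpha$ define elements $L^\alpha\in H_T^*[\partial]\otimes\mathbb Z[\partial]\otimes\mathbb Z[\partial]$, $\Lambda^\alpha\in K_T^*[\mathring\delta]\otimes\mathbb Z[\mathring\delta]\otimes\mathbb Z[\mathring\delta]$ and $\Lambda^\alpha_\circ\in K_T^*[\delta]\otimes\mathbb Z[\delta]\otimes\mathbb Z[\delta]$ by $$L^\alpha:=\partial_\alpha r_\alpha\otimes1\otimes1+r_\alpha\otimes\partial_\alpha\otimes1+r_\alpha\otimes1\otimes\partial_\alpha+\alpha r_\alpha\otimes\partial_\alpha\otimes\partial_\alpha,$$ $$\Lambda^\alpha:=(-e^{\alpha})r_\alpha(-\mathring\delta_\alpha)\otimes1\otimes1+r_\alpha\otimes\mathring\delta_\alpha\otimes1+r_\alpha\otimes1\otimes\mathring\delta_\alpha-(1-e^{-\alpha})r_\alpha\otimes\mathring\delta_\alpha\otimes\mathring\delta_\alpha,$$ $$\Lambda^\alpha_\circ:=e^{-\alpha}r_\alpha(-\delta_\alpha)\otimes1\otimes1+e^{-\alpha}r_\alpha\otimes\delta_\alpha\otimes1+e^{-\alpha}r_\alpha\otimes1\otimes\delta_\alpha+(1-e^{-\alpha})r_\alpha\otimes\delta_\alpha\otimes\delta_\alpha.$$ Then: (1) $(L^\alpha)^2=0$, $(\Lambda^\alpha)^2=\Lambda^\alpha$, and $(\Lambda^\alpha_\circ)^2=\Lambda^\alpha_\circ$. (2) If $\alpha,\beta$ are orthogonal simple roots, then $L^\alpha L^\beta=L^\beta L^\alpha$, $\Lambda^\alpha\Lambda^\beta=\Lambda^\beta\Lambda^\alpha$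 and $\Lambda^\alpha_\circ\Lambda^\beta_\circ=\Lambda^\beta_\circ\Lambda^\alpha_\circ$. (3) If $\alpha,\beta$ are simple roots spanning a root system of type $A_2$, then $L^\alpha L^\beta L^\alpha=L^\beta L^\alpha L^\beta$, $\Lambda^\alpha\Lambda^\beta\Lambda^\alpha=\Lambda^\beta\Lambda^\alpha\Lambda^\beta$ and $\Lambda_\circ^\alpha\Lambda_\circ^\beta\Lambda_\circ^\alpha=\Lambda_\circ^\beta\Lambda_\circ^\alpha\Lambda_\circ^\beta$. If $\alpha,\beta$ span a root system of type $B_2$, then $L^\alpha L^\beta L^\alpha L^\beta=L^\beta L^\alpha L^\beta L^\alpha$. (4) Consequently, for $w\in W$, the products $$L^w:=\prod_{q\in Q}L^{\alpha_q},\qquad\Lambda^w:=\prod_{q\in Q}\Lambda^{\alpha_q},\qquad\Lambda^w_\circ:=\prod_{q\in Q}\Lambda^{\alpha_q}_\circ$$ over a reduced word $Q$ for $w$ do not depend on the choice of $Q$, provided $W$ is simply laced (for $L^w$: simply or doubly laced). For $\Lambda^w$ and $\Lambda^w_\circ$ the same products are obtained from any word $Q$ whose Demazure product is $w$.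
   Context: $G$ is a complex reductive (or Kac-Moody) group with maximal torus $T$, Weyl group $W$ with length function $\ell$, simple roots $\alpha$ and simple reflections $r_\alpha$; $T^*$ is the weight lattice; $H_T^*=\mathrm{Sym}(T^* )$ over $\mathbb Z$; $K_T^*$ is the ring of finite sums $\sum_{\lambda\in T^*}m_\lambda e^\lambda$, $m_\lambda\in\mathbb Z$. $W$ acts on $H_T^*$ and $K_T^*$. $\mathbb Z[\partial]$ is the nil Hecke algebra with $\mathbb Z$-basis $\{\partial_w:w\in W\}$, $\partial_\alpha:=\partial_{r_\alpha}$, and $\partial_w\partial_{\alpha}=\partial_{wr_\alpha}$ if $\ell(wr_\alpha)=\ell(w)+1$, $=0$ otherwise. It acts on $H_T^*$ by $\partial_\alpha f=\frac{f-r_\alpha f}{\alpha}$. The zero Hecke algebra has $\mathbb Z$-basis indexed by $W$ with $\delta_w\delta_{r_\alpha}=\delta_{wr_\alpha}$ if $\ell(wr_\alpha)=\ell(w)+1$, $=\delta_w$ otherwise. It acts on $K_T^*$ in two ways, with generators acting by $\mathring\delta_\alpha f=\frac{f-r_\alpha f}{1-e^{-\alpha}}$ or by $\delta_\alpha f=\frac{f-e^{-\alpha}r_\alpha f}{1-e^{-\alpha}}$; the zero Hecke algebra is written $\mathbb Z[\mathring\delta]$ or $\mathbb Z[\delta]$ according to which action is intended (as abstract algebras they are isomorphic). $H_T^*[\partial]$ is the free left $H_T^*$-module $H_T^*\otimes_{\mathbb Z}\mathbb Z[\partial]$ with the algebra structure (Kostant-Kumar) containing $H_T^*$ and $\mathbb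 Z[\partial]$ as subrings and with the cross relation $\partial_\alpha p=\partial_\alpha(p)+r_\alpha(p)\,\partial_\alpha$ for $p\in H_T^*$. In it, $r_\alpha$ denotes $1-\alpha\partial_\alpha$. Similarly $K_T^*[\mathring\delta]$ and $K_T^*[\delta]$ are the free left $K_T^*$-modules on $\{\mathring\delta_w\}$, $\{\delta_w\}$, containing $K_T^*$ and the zero Hecke algebra as subrings, with cross relations $\mathring\delta_\alpha p=\frac{p-r_\alpha(p)}{1-e^{-\alpha}}+r_\alpha(p)\mathring\delta_\alpha$ and $\delta_\alpha p=\frac{p-r_\alpha(p)}{1-e^{-\alpha}}+r_\alpha(p)\delta_\alpha$ for $p\in K_T^*$ (the relations satisfied by the operators on $K_T^*$). In $K_T^*[\mathring\delta]$, $r_\alpha$ denotes $1-(1-e^{-\alpha})\mathring\delta_\alpha$; in $K_T^*[\delta]$, $r_\alpha$ denotes $e^\alpha(1-(1-e^{-\alpha})\delta_\alpha)$. Tensor products are over $\mathbb Z$, with factorwise multiplication. A word $Q$ is a finite sequence of simple reflections; $\alpha_q$ is the simple root of the letter $q$; products over $Q$ are taken in the left-to-right order of $Q$. The Demazure product of a word is the product of its letters for the associative operation on $W$ with $w*r_\alpha=wr_\alpha$ if $\ell(wr_\alpha)=\ell(w)+1$ and $w*r_\alpha=w$ otherwise. $W$ is simply laced if any two distinct simple roots are orthogonal or span a system of type $A_2$; doubly laced if any two distinct simple roots are orthogonal or span a system of type $A_2$ or $B_2$. *)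

(* Defs.v *)
From HB Require Import structures.
From mathcomp Require Import all_boot all_order all_algebra.
From mathcomp Require Import finmap.
From mathcomp.multinomials Require Import -(notations) monalg.
From mathcomp.multinomials Require Import mpoly.
From mathcomp Require boolp.

Set Implicit Arguments.
Unset Strict Implicit.
Unset Printing Implicit Defensive.

Import GRing.Theory Num.Theory.
Local Open Scope ring_scope.

(* The notations of monalg collide with those of mpoly. *)
Local Notation "g @_ k" := (monalg.mcoeff k g)
  (at level 3, k at level 2, left associativity, format "g @_ k") : ring_scope.
Local Notation msupp := monalg.msupp.

(* The weight lattice T^* is Z^n, written as column vectors, so
   that a matrix w acts on a weight x by w *m x and composition of operators is
   the matrix product; coweights are row vectors. *)

Definition pairing (n : nat) (c : 'rV[int]_n) (x : 'cV[int]_n) : int :=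
  (c *m x) 0 0.

(* The generalized Cartan matrix need not be of finite type, which allows
   Kac-Moody groups; finite type is the reductive case. *)
Record root_datum (n : nat) (I : finType) := RootDatum {
  sroot : I -> 'cV[int]_n;
  scoroot : I -> 'rV[int]_n;
  pairing_diag : forall i, pairing (scoroot i) (sroot i) = 2;
  pairing_offdiag : forall i j, i != j -> pairing (scoroot i) (sroot j) <= 0;
  pairing_sym0 : forall i j,
    pairing (scoroot i) (sroot j) = 0 -> pairing (scoroot j) (sroot i) = 0;
  sroot_free : forall c : I -> int,
    \sum_i c i *: sroot i = 0 -> forall i, c i = 0;
  scoroot_free : forall c : I -> int,
    \sum_i c i *: scoroot i = 0 -> forall i, c i = 0
}.

Section Weyl.
Context (n : nat) (I : finType) (D : root_datum n I).

Definition cartan (i j : I) : int := pairing (scoroot D i) (sroot D j).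

Definition orthogonal_roots (i j : I) : Prop := cartan i j = 0 /\ cartan j i = 0.

Definition span_A2 (i j : I) : Prop := cartan i j = -1 /\ cartan j i = -1.

Definition span_B2 (i j : I) : Prop :=
  (cartan i j = -1 /\ cartan j i = -2) \/ (cartan i j = -2 /\ cartan j i = -1).

Definition simply_laced : Prop :=
  forall i j, i != j -> orthogonal_roots i j \/ span_A2 i j.

Definition doubly_laced : Prop :=
  forall i j, i != j -> [\/ orthogonal_roots i j, span_A2 i j | span_B2 i j].

(* x |-> x - <x, alpha_i^vee> alpha_i *)
Definition reflmx (i : I) : 'M[int]_n := 1 - sroot D i *m scoroot D i.

Definition wordmx (Q : seq I) : 'M[int]_n := \prod_(i <- Q) reflmx i.

(* Reflections are involutions, so the products of simple reflections form the
   subgroup of GL(T^* ) that they generate. *)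
Definition in_weyl (w : 'M[int]_n) : bool :=
  boolp.asbool (exists Q : seq I, wordmx Q = w).

Record weyl : predArgType := Weyl { wmx : 'M[int]_n; wmxP : in_weyl wmx }.

HB.instance Definition _ := [isSub for wmx].
HB.instance Definition _ := [Choice of weyl by <:].

Fact in_weyl_word (Q : seq I) : in_weyl (wordmx Q).
Proof. by apply/boolp.asboolP; exists Q. Qed.

Definition word_elt (Q : seq I) : weyl := Weyl (in_weyl_word Q).

Definition weyl1 : weyl := word_elt [::].
Definition srefl (i : I) : weyl := word_elt [:: i].

Fact in_weylM (v w : weyl) : in_weyl (wmx v * wmx w).
Proof.
case: v w => v vP [w wP] /=; apply/boolp.asboolP.
have [P <-] := boolp.asboolW vP; have [Q <-] := boolp.asboolW wP.
by exists (P ++ Q); rewrite /wordmx big_cat.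
Qed.

Definition weylM (v w : weyl) : weyl := Weyl (in_weylM v w).

Fact ex_word_size (w : weyl) :
  exists k, [exists Q : k.-tuple I, word_elt Q == w].
Proof.
case: w => w wP; have [Q Qw] := boolp.asboolW wP.
by exists (size Q); apply/existsP; exists (in_tuple Q); apply/eqP/val_inj.
Qed.

Definition wlen (w : weyl) : nat := ex_minn (ex_word_size w).

Definition reduced_word (w : weyl) (Q : seq I) : Prop :=
  word_elt Q = w /\ size Q = wlen w.

Definition ascends (w : weyl) (i : I) : bool :=
  wlen (weylM w (srefl i)) == (wlen w).+1.

Definition demazure (Q : seq I) : weyl :=
  foldl (fun w i => if ascends w i then weylM w (srefl i) else w) weyl1 Q.

End Weyl.

(* The group ring Z[Z^n].  The product of monalg is only available over conical
   monoids, so {malg int[_]} provides just the additive structure here. *)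

Definition charring (n : nat) : Type := monalg.malg 'cV[int]_n int.

HB.instance Definition _ n := GRing.Zmodule.on (charring n).

(* a e^x; the locks keep unification fast. *)
HB.lock Definition crU (n : nat) (a : int) (x : 'cV[int]_n) : charring n :=
  monalg.mkmalgU x a.

HB.lock Definition cr_mul (n : nat) (f g : charring n) : charring n :=
  \sum_(x <- msupp f) \sum_(y <- msupp g) crU (f@_x * g@_y) (x + y).

HB.lock Definition cr_one (n : nat) : charring n := crU 1 0.

Section CharRing.
Context (n : nat).
Implicit Types (f g h : charring n) (x y : 'cV[int]_n).
Local Notation cr_mul := (@cr_mul n).

Definition cexp x : charring n := crU 1 x.

Lemma crUE a x : crU a x = monalg.mkmalgU x a.
Proof. by rewrite crU.unlock. Qed.

Lemma crU0 x : crU 0 x = 0.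
Proof. by rewrite crUE monalg.monalgU0. Qed.

Lemma crUD a b x : crU (a + b) x = crU a x + crU b x.
Proof. by rewrite !crUE monalg.monalgUD. Qed.

Lemma charringE f : f = \sum_(x <- msupp f) crU f@_x x.
Proof.
by rewrite {1}[f]monalg.monalgE; apply/eq_bigr => x _; rewrite crUE.
Qed.

Lemma cr_mulwl (d1 d2 : {fset 'cV[int]_n}) f g :
  (msupp f `<=` d1)%fset -> (msupp g `<=` d2)%fset ->
  cr_mul f g = \sum_(x <- d1) \sum_(y <- d2) crU (f@_x * g@_y) (x + y).
Proof.
move=> le1 le2; rewrite cr_mul.unlock (big_fset_incl _ le1) /=.
  apply/eq_bigr => x _; apply/big_fset_incl => // y _ /monalg.mcoeff_outdom ->.
  by rewrite mulr0 crU0.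
move=> x _ /monalg.mcoeff_outdom fx.
by rewrite big1 // => y _; rewrite fx mul0r crU0.
Qed.

Lemma cr_mulC : commutative cr_mul.
Proof.
move=> f g; rewrite !cr_mul.unlock exchange_big /=.
by apply/eq_bigr => x _; apply/eq_bigr => y _; rewrite mulrC addrC.
Qed.

Lemma cr_mulDl : left_distributive cr_mul +%R.
Proof.
move=> f g h; rewrite (cr_mulwl (monalg.msuppD_le f g) (fsubset_refl _)).
rewrite (cr_mulwl (fsubsetUl _ (msupp g)) (fsubset_refl (msupp h))).
rewrite (cr_mulwl (fsubsetUr (msupp f) (msupp g)) (fsubset_refl (msupp h))).
rewrite -big_split; apply/eq_bigr => x _ /=.
rewrite -big_split; apply/eq_bigr => y _ /=.
by rewrite monalg.mcoeffD mulrDl crUD.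
Qed.

Lemma cr_mulDr : right_distributive cr_mul +%R.
Proof. by move=> f g h; rewrite !(cr_mulC f) cr_mulDl. Qed.

Lemma cr_mulUU a b x y : cr_mul (crU a x) (crU b y) = crU (a * b) (x + y).
Proof.
rewrite (crUE a) (crUE b) (cr_mulwl monalg.msuppU_le monalg.msuppU_le).
by rewrite !big_seq_fset1 !monalg.mcoeffUU.
Qed.

Lemma cr_mul0g : left_zero 0 cr_mul.
Proof. by move=> f; rewrite cr_mul.unlock monalg.msupp0 big_seq_fset0. Qed.

Lemma cr_mulg0 : right_zero 0 cr_mul.
Proof. by move=> f; rewrite cr_mulC cr_mul0g. Qed.

Lemma cr_mul_suml (J : Type) (r : seq J) (F : J -> charring n) g :
  cr_mul (\sum_(j <- r) F j) g = \sum_(j <- r) cr_mul (F j) g.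
Proof.
exact: (big_morph (cr_mul^~ g) (fun a b => cr_mulDl a b g) (cr_mul0g g)).
Qed.

Lemma cr_mul_sumr (J : Type) (r : seq J) (F : J -> charring n) g :
  cr_mul g (\sum_(j <- r) F j) = \sum_(j <- r) cr_mul g (F j).
Proof. exact: (big_morph (cr_mul g) (cr_mulDr g) (cr_mulg0 g)). Qed.

Lemma cr_mulA : associative cr_mul.
Proof.
move=> f g h; rewrite (charringE f) 3!cr_mul_suml; apply/eq_bigr => x _.
move: (f@_x) => a; rewrite (charringE g) cr_mul_suml 2!cr_mul_sumr cr_mul_suml.
apply/eq_bigr => y _; move: (g@_y) => b; rewrite (charringE h) 3!cr_mul_sumr.
by apply/eq_bigr => z _; rewrite !cr_mulUU mulrA addrA.
Qed.

Lemma cr_mul1 : left_id (cr_one n) cr_mul.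
Proof.
rewrite cr_one.unlock => f; rewrite [f in LHS]charringE [RHS]charringE cr_mul_sumr.
by apply/eq_bigr => x _; rewrite cr_mulUU mul1r add0r.
Qed.

Lemma cr_oner_neq0 : cr_one n != 0.
Proof. by rewrite cr_one.unlock crUE monalg.monalgU_eq0 oner_eq0. Qed.

HB.instance Definition _ := GRing.Zmodule_isComNzRing.Build (charring n)
  cr_mulA cr_mulC cr_mul1 cr_mulDl cr_oner_neq0.

Lemma cexpD x y : cexp (x + y) = cexp x * cexp y.
Proof. by rewrite [RHS]cr_mulUU mulr1. Qed.

Lemma crU_cexp a x y : crU a x * cexp y = crU a (x + y).
Proof. by rewrite [LHS]cr_mulUU mulr1. Qed.

Lemma cexp0 : cexp 0 = 1. Proof. by rewrite -[RHS]/(cr_one n) cr_one.unlock. Qed.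

Lemma mcoeff_cexpM x f y : (cexp x * f)@_y = f@_(y - x).
Proof.
rewrite {1}(charringE f) mulr_sumr (raddf_sum (monalg.mcoeff y)) /=.
rewrite [in RHS](charringE f) (raddf_sum (monalg.mcoeff (y - x))) /=.
apply/eq_bigr => z _; rewrite [cexp x * _]mulrC crU_cexp !crUE !monalg.mcoeffU.
by rewrite (can2_eq (addrK x) (subrK x)).
Qed.

Lemma cexp_fix_eq0 x f : x != 0 -> cexp x * f = f -> f = 0.
Proof.
move=> x0 xf; apply/monalg.malgP => y; rewrite monalg.mcoeff0; apply/eqP.
apply: contraT => fy; pose s := [seq y - x *+ k | k <- iota 0 (size (msupp f)).+1].
have us : uniq s.
  rewrite map_inj_in_uniq ?iota_uniq // => k l _ _ /addrI/oppr_inj kl.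
  have [j xj] : exists j, x j 0 != 0.
    apply/existsP; apply: contraNT x0; rewrite negb_exists => /forallP x0.
    by apply/eqP/matrixP => j c; rewrite ord1 mxE; apply/eqP/negPn/x0.
  move/(congr1 (fun M : 'cV[int]_n => M j 0)): kl.
  rewrite -!scaler_nat !mxE => /(mulIf xj)/eqP.
  by rewrite eqr_nat => /eqP.
have ss : {subset s <= msupp f}.
  move=> _ /mapP[k _ ->]; rewrite -monalg.mcoeff_neq0.
  elim: k => [|k IH]; first by rewrite mulr0n subr0.
  by rewrite mulrSr opprD addrA -mcoeff_cexpM xf.
by have := uniq_leq_size us ss; rewrite size_map size_iota ltnn.
Qed.

End CharRing.

(* Actions of W, and the operators f |-> (f - r_i f)/alpha_i on H_T^* and
   f |-> (f - r_i f)/(1 - e^(-alpha_i)) on K_T^*. *)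

Section Actions.
Context (n : nat) (I : finType) (D : root_datum n I).

Definition wt (x : 'cV[int]_n) : {mpoly int[n]} := \sum_(k < n) x k 0 *: 'X_k.

(* The ring automorphism extending x |-> w x: 'X_k is the k-th basis weight and
   w maps it to the k-th column of w. *)
Definition actH (w : 'M[int]_n) (f : {mpoly int[n]}) : {mpoly int[n]} :=
  f \mPo [tuple wt (col k w) | k < n].

Definition actK (w : 'M[int]_n) (f : charring n) : charring n :=
  \sum_(x <- msupp f) crU f@_x (w *m x).

Definition reflH (i : I) := actH (reflmx D i).
Definition reflK (i : I) := actK (reflmx D i).

Definition rootH (i : I) : {mpoly int[n]} := wt (sroot D i).
Definition rootK (i : I) : charring n := 1 - cexp (- sroot D i).

Lemma wtD x y : wt (x + y) = wt x + wt y.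
Proof. by rewrite -big_split; apply/eq_bigr => k _; rewrite mxE scalerDl. Qed.

Lemma wtZ a x : wt (a *: x) = a *: wt x.
Proof. by rewrite scaler_sumr; apply/eq_bigr => k _; rewrite mxE scalerA. Qed.

Lemma reflmxE i x : reflmx D i *m x = x - pairing (scoroot D i) x *: sroot D i.
Proof.
rewrite mulmxBl mul1mx -mulmxA; congr (_ - _).
by rewrite [scoroot D i *m x]mx11_scalar mul_mx_scalar.
Qed.

Lemma reflH_X i (k : 'I_n) : reflH i 'X_k = wt (col k (reflmx D i)).
Proof. by rewrite /reflH /actH comp_mpolyXU -tnth_nth tnth_mktuple. Qed.

Lemma wt_delta (k : 'I_n) : wt (delta_mx k 0) = 'X_k.
Proof.
rewrite /wt (bigD1 k) //= big1 => [|j /negbTE jk]; rewrite mxE eqxx.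
  by rewrite eqxx scale1r addr0.
by rewrite jk scale0r.
Qed.

Lemma ex_ddiffH i f : exists g, rootH i * g == f - reflH i f.
Proof.
suff [g fg] : exists g, rootH i * g = f - reflH i f by exists g; apply/eqP.
pose P p := exists g, rootH i * g = p - reflH i p.
have PC c : P c%:MP.
  by exists 0; rewrite mulr0 /reflH /actH comp_mpolyC subrr.
have PD p q : P p -> P q -> P (p + q).
  move=> [g gp] [h hq]; exists (g + h).
  by rewrite mulrDr gp hq /reflH /actH raddfD opprD addrACA.
have PM p q : P p -> P q -> P (p * q).
  move=> [g gp] [h hq]; exists (g * q + reflH i p * h).
  rewrite mulrDr mulrA gp mulrCA hq [reflH i (p * q)]rmorphM /=.
  by rewrite mulrBl mulrBr addrA subrK.
have PX k : P 'X_k.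
  exists (pairing (scoroot D i) (delta_mx k 0))%:MP.
  rewrite reflH_X colE reflmxE -scaleNr wtD wtZ wt_delta opprD addrA subrr add0r.
  by rewrite scaleNr opprK mulrC mul_mpolyC.
rewrite [f]mpolyE; apply: (big_ind P) => [||m _]; [exact: (PC 0)|exact: PD|].
rewrite -mul_mpolyC; apply: (PM) => //; rewrite mpolyXE_id.
apply: (big_ind P) => [||k _]; [exact: (PC 1)|exact: (PM)|].
by elim: (m k) => [|d IH]; rewrite ?expr0 ?exprS; [exact: (PC 1)|exact: (PM)].
Qed.

Lemma actK_wE w (E : {fset 'cV[int]_n}) (f : charring n) :
  (msupp f `<=` E)%fset ->
  actK w f = \sum_(x <- E) (crU f@_x (w *m x)).
Proof.
move=> le; apply/big_fset_incl => // x _ /monalg.mcoeff_outdom ->.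
exact: crU0.
Qed.

Lemma actKD w (f g : charring n) : actK w (f + g) = actK w f + actK w g.
Proof.
rewrite (actK_wE w (monalg.msuppD_le f g)) (actK_wE w (fsubsetUl _ (msupp g))).
rewrite (actK_wE w (fsubsetUr (msupp f) _)) -big_split /=.
by apply/eq_bigr => x _; rewrite monalg.mcoeffD crUD.
Qed.

Lemma actKU w a (x : 'cV[int]_n) : actK w (crU a x) = crU a (w *m x).
Proof.
rewrite {1}crUE (actK_wE w monalg.msuppU_le).
by rewrite big_seq_fset1 monalg.mcoeffUU.
Qed.

Lemma actK_exp w (x : 'cV[int]_n) : actK w (cexp x) = cexp (w *m x).
Proof. exact: actKU. Qed.

Lemma cexpMn (x : 'cV[int]_n) (m : nat) : cexp (x *+ m) = cexp x ^+ m.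
Proof. by elim: m => [|m IH]; rewrite ?cexp0 // mulrS exprS cexpD IH. Qed.

Lemma rootK_dvd i (m : int) :
  exists g, rootK i * g = 1 - cexp (- (m *: sroot D i)).
Proof.
have geom (k : nat) : exists g, rootK i * g = 1 - cexp (- (k%:Z *: sroot D i)).
  exists (\sum_(j < k) cexp (- sroot D i) ^+ j).
  have := subrX1 (cexp (- sroot D i)) k.
  move/(congr1 -%R); rewrite opprB -mulNr opprB => <-.
  by rewrite -cexpMn mulNrn -natz scaler_nat.
case: m => k; first exact: geom.
have [g gk] := geom k.+1; rewrite NegzE scaleNr opprK.
set y := _ *: _ in gk *; exists (- cexp y * g).
rewrite mulrCA gk mulrBr mulr1 mulNr -cexpD (addrN y) cexp0 opprK.
exact: addrC.
Qed.

Lemma ex_ddiffK i f : exists g, rootK i * g == f - reflK i f.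
Proof.
suff [g fg] : exists g, rootK i * g = f - reflK i f by exists g; apply/eqP.
pose P (p : charring n) := exists g, rootK i * g = p - reflK i p.
have PD p q : P p -> P q -> P (p + q).
  move=> [g gp] [h hq]; exists (g + h).
  by rewrite mulrDr gp hq /reflK actKD opprD addrACA.
rewrite (charringE f); apply: (big_ind P) => [||x _]; [|exact: PD|].
  by exists 0; rewrite mulr0 /reflK /actK monalg.msupp0 big_seq_fset0 subr0.
have [g gx] := rootK_dvd i (pairing (scoroot D i) x).
exists (crU f@_x x * g); rewrite mulrCA gx {gx} mulrBr mulr1 crU_cexp.
by rewrite /reflK actKU reflmxE.
Qed.

Definition ddiffH i f := xchoose (ex_ddiffH i f).
Definition ddiffK i f := xchoose (ex_ddiffK i f).

Lemma ddiffHE i f : rootH i * ddiffH i f = f - reflH i f.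
Proof. exact/eqP/(xchooseP (ex_ddiffH i f)). Qed.

Lemma ddiffKE i f : rootK i * ddiffK i f = f - reflK i f.
Proof. exact/eqP/(xchooseP (ex_ddiffK i f)). Qed.

Lemma sroot_neq0 i : sroot D i != 0.
Proof.
by apply/eqP => i0; have := pairing_diag D i; rewrite i0 /pairing mulmx0 mxE.
Qed.

Lemma rootH_neq0 i : rootH i != 0.
Proof.
apply: contra (sroot_neq0 i) => /eqP i0; apply/eqP/matrixP => k c.
rewrite ord1 mxE; have := congr1 (mcoeff U_(k)) i0.
rewrite mcoeff0 /rootH /wt raddf_sum (bigD1 k) //= big1 => [|j jk].
  by rewrite mcoeffZ mcoeffX eqxx mulr1 addr0.
by rewrite mcoeffZ mcoeffX eq_mnm1 (negbTE jk) mulr0.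
Qed.

Lemma ddiffH_uniq i f g : rootH i * g = f - reflH i f -> g = ddiffH i f.
Proof. by rewrite -ddiffHE => /(mulfI (rootH_neq0 i)). Qed.

Lemma ddiffK_uniq i f g : rootK i * g = f - reflK i f -> g = ddiffK i f.
Proof.
rewrite -ddiffKE => /eqP; rewrite -subr_eq0 -mulrBr mulrBl mul1r subr_eq0 eq_sym.
move=> /eqP/cexp_fix_eq0 gd; apply/eqP; rewrite -subr_eq0 gd //.
by rewrite oppr_eq0 sroot_neq0.
Qed.

End Actions.

(* b is a basis of A as a left module over R, acting through iota. *)
Definition left_basis (R A : nzRingType) (iota : R -> A) (J : choiceType)
    (b : J -> A) : Prop :=
  forall a : A, exists! c : {fsfun J -> R with 0},
    a = \sum_(j <- finsupp c) iota (c j) * b j.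

(* The algebras Z[partial], H_T^*[partial], ... are determined up to a unique
   isomorphism by these specifications. *)

Section HeckeAlgebras.
Context (n : nat) (I : finType) (D : root_datum n I).

Record nil_hecke := NilHecke {
  nh_ring :> nzRingType;
  nh_elt : weyl D -> nh_ring;
  nh_basis : left_basis (intr : int -> nh_ring) nh_elt;
  nh_mul : forall w i, nh_elt w * nh_elt (srefl D i) =
    if ascends w i then nh_elt (weylM w (srefl D i)) else 0
}.

Definition nh_gen (N : nil_hecke) (i : I) : N := nh_elt N (srefl D i).

Record zero_hecke := ZeroHecke {
  zh_ring :> nzRingType;
  zh_elt : weyl D -> zh_ring;
  zh_basis : left_basis (intr : int -> zh_ring) zh_elt;
  zh_mul : forall w i, zh_elt w * zh_elt (srefl D i) =
    if ascends w i then zh_elt (weylM w (srefl D i)) else zh_elt w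
}.

Definition zh_gen (Z : zero_hecke) (i : I) : Z := zh_elt Z (srefl D i).

(* H_T^*[partial] *)
Record nil_hecke_ext (N : nil_hecke) := NilHeckeExt {
  nhx_ring :> nzRingType;
  nhx_scal : {rmorphism {mpoly int[n]} -> nhx_ring};
  nhx_incl : {rmorphism N -> nhx_ring};
  nhx_basis : left_basis nhx_scal (fun w => nhx_incl (nh_elt N w));
  nhx_cross : forall i p,
    nhx_incl (nh_gen N i) * nhx_scal p =
    nhx_scal (ddiffH D i p) + nhx_scal (reflH D i p) * nhx_incl (nh_gen N i)
}.

(* Both K_T^*[mathring delta] and K_T^*[delta]: the two actions of the zero Hecke
   algebra on K_T^* satisfy the same cross relation, and differ only through the
   element called r_i below. *)
Record zero_hecke_ext (Z : zero_hecke) := ZeroHeckeExt {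
  zhx_ring :> nzRingType;
  zhx_scal : {rmorphism charring n -> zhx_ring};
  zhx_incl : {rmorphism Z -> zhx_ring};
  zhx_basis : left_basis zhx_scal (fun w => zhx_incl (zh_elt Z w));
  zhx_cross : forall i p,
    zhx_incl (zh_gen Z i) * zhx_scal p =
    zhx_scal (ddiffK D i p) + zhx_scal (reflK D i p) * zhx_incl (zh_gen Z i)
}.

End HeckeAlgebras.

Definition triadditive (A B C V : zmodType) (f : A -> B -> C -> V) : Prop :=
  [/\ forall a a' b c, f (a + a') b c = f a b c + f a' b c,
      forall a b b' c, f a (b + b') c = f a b c + f a b' c
    & forall a b c c', f a b (c + c') = f a b c + f a b c'].

(* The tensor product of three rings over Z, by its universal property. *)
Record tensor3 (A B C : nzRingType) := Tensor3 {
  t3_ring :> nzRingType;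
  pure : A -> B -> C -> t3_ring;
  pure_add : triadditive pure;
  pure1 : pure 1 1 1 = 1;
  pureM : forall a b c a' b' c',
    pure a b c * pure a' b' c' = pure (a * a') (b * b') (c * c');
  t3_lift : forall (V : zmodType) (f : A -> B -> C -> V), triadditive f ->
    exists g : {additive t3_ring -> V}, forall a b c, g (pure a b c) = f a b c;
  t3_uniq : forall (V : zmodType) (g h : {additive t3_ring -> V}),
    (forall a b c, g (pure a b c) = h (pure a b c)) -> g =1 h
}.

Section Elements.
Context (n : nat) (I : finType) (D : root_datum n I).

Section Cohomology.
Context (N : nil_hecke D) (A : nil_hecke_ext N) (T : tensor3 A N N) (i : I).

Let d : A := nhx_incl A (nh_gen N i).
Let al : A := nhx_scal A (rootH D i).

Definition r_nil : A := 1 - al * d.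

Definition L_elt : T :=
  pure T (d * r_nil) 1 1 + pure T r_nil (nh_gen N i) 1
  + pure T r_nil 1 (nh_gen N i) + pure T (al * r_nil) (nh_gen N i) (nh_gen N i).

End Cohomology.

Section KTheory.
Context (Z : zero_hecke D) (A : zero_hecke_ext Z) (T : tensor3 A Z Z) (i : I).

Let d : A := zhx_incl A (zh_gen Z i).
Let e (x : 'cV[int]_n) : A := zhx_scal A (cexp x).
Let al : 'cV[int]_n := sroot D i.

(* mathring delta_i acts as (f - r_i f)/(1 - e^(-alpha_i)). *)
Definition r_ring : A := 1 - (1 - e (- al)) * d.

Definition Lambda_elt : T :=
  pure T (- e al * r_ring * - d) 1 1 + pure T r_ring (zh_gen Z i) 1
  + pure T r_ring 1 (zh_gen Z i)
  - pure T ((1 - e (- al)) * r_ring) (zh_gen Z i) (zh_gen Z i).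

(* delta_i acts as (f - e^(-alpha_i) r_i f)/(1 - e^(-alpha_i)). *)
Definition r_circ : A := e al * (1 - (1 - e (- al)) * d).

Definition Lambdao_elt : T :=
  pure T (e (- al) * r_circ * - d) 1 1 + pure T (e (- al) * r_circ) (zh_gen Z i) 1
  + pure T (e (- al) * r_circ) 1 (zh_gen Z i)
  + pure T ((1 - e (- al)) * r_circ) (zh_gen Z i) (zh_gen Z i).

End KTheory.

End Elements.

(* Main.v *)
(* Let x = alpha, d = -partial_alpha for L, x = 1 - e^(-alpha), d = delta_alpha
   for Lambda, and x = 1 - e^alpha, d = delta_alpha for Lambda_o.  With
   h(x) = 1 - x d, the elements D = -L, Lambda, Lambda_o are the divided
   differences (1 - R) / x of R = h_2(x) h_3(x) r, where h_2 and h_3 have d in the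
   second and third tensor factor and r is the reflection.  The Yang-Baxter
   equations for h say that, like the reflections r, the elements R are involutions
   satisfying the braid relations; multiplied by the product of the x attached to
   the positive roots of a rank two system, the longest product of the D is the
   alternating sum of the products of the R, which gives the braid relations for D,
   as the x are not zero divisors.  The same formula, read backwards, gives the
   braid relations for r.

   Independence of the reduced word is Matsumoto's theorem, deduced from the
   exchange condition; the latter rests on the positivity of w (alpha_i) when
   l(w r_i) > l(w), proved as by Tits through the dihedral subgroups, which have
   order 4, 6 or 8 here. *)

Require Import Defs.
From HB Require Import structures.
From mathcomp Require Import all_boot all_order all_algebra.
From mathcomp Require Import zify ring.
From mathcomp Require Import finmap.
From mathcomp.multinomials Require Import -(notations) monalg.
From mathcomp.multinomials Require Import mpoly.
From mathcomp Require boolp.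
From Stdlib Require Ncring Ncring_tac.

Set Implicit Arguments.
Unset Strict Implicit.
Unset Printing Implicit Defensive.

Import Order.TTheory GRing.Theory Num.Theory.
Local Open Scope ring_scope.

(* For pzRingType rather than nzRingType, so as to apply to 'M[int]_n. *)
#[export] Instance pzRing_ops (R : pzRingType) :
  @Ncring.Ring_ops R 0 1 +%R *%R (fun x y => x - y) -%R eq := {}.
#[export] Instance pzRing_ring (R : pzRingType) :
  @Ncring.Ring R 0 1 +%R *%R (fun x y => x - y) -%R eq (pzRing_ops R).
Proof.
split; try exact _; [exact: add0r | exact: addrC | exact: addrA | exact: mul1r
  | exact: mulr1 | exact: mulrA | exact: mulrDl | | by [] | exact: subrr].
by move=> x y z; exact: mulrDr.
Qed.

Ltac ncring := Ncring_tac.non_commutative_ring.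

(** Rebrackets the left-hand side so that the product to be rewritten next becomes a visible
    subterm. *)
Ltac reassoc t := transitivity t; [ncring |].

(** * Identities in noncommutative rings *)

Section DividedDifferences.
Context (A : pzRingType) (Ra Rb Da Db x y : A).
Hypotheses (xDa : x * Da = 1 - Ra) (yDb : y * Db = 1 - Rb) (xy : x * y = y * x).

Lemma divdiff_comm : Ra * y = y * Ra ->
  x * y * (Da * Db) = (1 - Ra) * (1 - Rb).
Proof.
move=> Ray; rewrite xy.
reassoc (y * (x * Da) * Db); rewrite xDa.
reassoc (y * Db - (y * Ra) * Db); rewrite -Ray.
reassoc ((1 - Ra) * (y * Db)); by rewrite yDb.
Qed.

(** Type A_2: [x], [y], [z] belong to alpha, beta, alpha + beta, and [z = x + y * t] is the group
    law. Once the weights have been carried past the reflections, each divided difference meets its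
    own weight; the right-hand side is the alternating sum over the dihedral group of order 6. *)
Lemma divdiff_braid3 (z t : A) : x * z = z * x -> y * z = z * y ->
  z = x + y * t -> Ra * y = z * Ra -> Ra * z = y * Ra -> Rb * x = z * Rb ->
  Ra * Da = t * Da ->
  x * y * z * (Da * Db * Da) = 1 - Ra - Rb + Ra * Rb + Rb * Ra - Ra * Rb * Ra.
Proof.
move=> xz yz ez Ray Raz Rbx RaD.
have e1 : z * (y * Db) = z - Rb * x by rewrite yDb Rbx; ncring.
have e2 : z * Da - y * (Ra * Da) = 1 - Ra.
  by rewrite RaD ez -xDa; ncring.
have -> : x * y * z = y * z * x by rewrite xy -mulrA xz mulrA.
reassoc (y * z * (x * Da) * Db * Da); rewrite xDa.
reassoc (y * z * Db * Da - y * (z * Ra) * Db * Da); rewrite -Ray.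
reassoc (y * z * Db * Da - (y * Ra) * y * Db * Da); rewrite -Raz.
rewrite yz; reassoc ((1 - Ra) * (z * (y * Db)) * Da); rewrite e1.
reassoc (z * Da - (Ra * z) * Da - (1 - Ra) * Rb * (x * Da)); rewrite Raz xDa.
reassoc (z * Da - y * (Ra * Da) - (1 - Ra) * Rb * (1 - Ra)); rewrite e2.
ncring.
Qed.

(** Type B_2 with the additive law: the positive roots are [x], [y], [u = x + y] and [t = x + 2 y].
    No braid relation is assumed on either side, so the two alternating sums of eight products stay
    factored and separate. *)
Lemma divdiff_braid4 (u t : A) : u = x + y -> t = x + y + y ->
  Ra * y = u * Ra -> Ra * u = y * Ra -> Ra * t = t * Ra ->
  Rb * x = t * Rb -> Rb * t = x * Rb -> Rb * u = u * Rb ->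
  Ra * Da = Da -> Rb * Db = Db ->
  x * y * u * t * (Da * Db * Da * Db) = (1 - Ra) * (1 + Rb * Ra) * (1 - Rb) /\
  x * y * u * t * (Db * Da * Db * Da) = (1 - Rb) * (1 + Ra * Rb) * (1 - Ra).
Proof.
move=> eu et Ray Rau Rat Rbx Rbt Rbu RaD RbD.
have xu : x * u = u * x by rewrite eu mulrDr mulrDl xy.
have yu : y * u = u * y by rewrite eu mulrDr mulrDl xy.
have xt : x * t = t * x by rewrite et !mulrDr !mulrDl xy.
have yt : y * t = t * y by rewrite et !mulrDr !mulrDl xy.
have ut : u * t = t * u by rewrite eu mulrDr mulrDl xt yt.
have yutC : y * u * t = u * t * y by rewrite yu -mulrA yt mulrA.
have xutC : x * u * t = u * t * x by rewrite xu -mulrA xt mulrA.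
have exD : u * Da - y * (Ra * Da) = 1 - Ra by rewrite RaD eu -xDa; ncring.
have eyD : t * Db - u * Db = 1 - Rb by rewrite et eu -yDb; ncring.
have eyD2 : t * Db - x * (Rb * Db) = (1 - Rb) + (1 - Rb).
  by rewrite RbD et -yDb; ncring.
have exD2 : u * Da + u * Da - t * Da = 1 - Ra by rewrite et eu -xDa; ncring.
(* [Ra] permutes the positive roots other than [x]: it swaps [y] with [u] and fixes [t], hence
   commutes with their product. In the same way [Rb] swaps [x] with [t] and fixes [u]. *)
have yut Z : (1 - Ra) * (y * u * t * Z) = y * u * t * Z - y * u * t * (Ra * Z).
  reassoc (y * u * t * Z - (Ra * y) * u * t * Z); rewrite Ray.
  reassoc (y * u * t * Z - u * (Ra * u) * t * Z); rewrite Rau.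
  reassoc (y * u * t * Z - u * y * (Ra * t) * Z); rewrite Rat yu.
  ncring.
have xut Z : (1 - Rb) * (x * u * t * Z) = x * u * t * Z - x * u * t * (Rb * Z).
  reassoc (x * u * t * Z - (Rb * x) * u * t * Z); rewrite Rbx.
  reassoc (x * u * t * Z - t * (Rb * u) * t * Z); rewrite Rbu.
  reassoc (x * u * t * Z - t * u * (Rb * t) * Z); rewrite Rbt.
  have -> : t * u * (x * Rb) = x * u * t * Rb.
    by rewrite mulrA -ut xutC.
  ncring.
split.
- have -> : x * y * u * t = y * u * t * x.
    by rewrite xy -!mulrA (mulrA x) xu -mulrA xt !mulrA.
  reassoc (y * u * t * ((x * Da) * Db * Da * Db)); rewrite xDa.
  reassoc (y * u * t * (Db * Da * Db) - y * u * t * (Ra * (Db * Da * Db))).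
  rewrite -yut.
  have e1 : u * (x * Da) * Db = u * Db - Ra * (y * Db) by rewrite xDa mulrA Ray; ncring.
  have -> : y * u * t * (Db * Da * Db) = u * t * (y * Db) * Da * Db.
    by rewrite yutC; ncring.
  rewrite yDb.
  have -> : u * t * (1 - Rb) * Da * Db = u * t * Da * Db - Rb * (u * (x * Da) * Db).
    reassoc (u * t * Da * Db - u * (t * Rb) * Da * Db); rewrite -Rbx.
    reassoc (u * t * Da * Db - (u * Rb) * x * Da * Db); rewrite -Rbu; ncring.
  rewrite e1 yDb.
  have e3 : (1 - Ra) * (u * t * Da * Db) = (1 - Ra) * t * Db.
    rewrite ut; reassoc (t * u * Da * Db - (Ra * t) * u * Da * Db); rewrite Rat.
    reassoc (t * u * Da * Db - t * (Ra * u) * Da * Db); rewrite Rau.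
    reassoc (t * (u * Da - y * (Ra * Da)) * Db); rewrite exD.
    reassoc (t * Db - (t * Ra) * Db); rewrite -Rat; ncring.
  reassoc ((1 - Ra) * (u * t * Da * Db) - (1 - Ra) * ((Rb * u) * Db)
    + (1 - Ra) * Rb * Ra * (1 - Rb)); rewrite e3 Rbu.
  reassoc ((1 - Ra) * (t * Db - u * (Rb * Db)) + (1 - Ra) * Rb * Ra * (1 - Rb)).
  by rewrite RbD eyD; ncring.
have -> : x * y * u * t = x * u * t * y.
  by rewrite -!mulrA (mulrA y) yu -mulrA yt !mulrA.
reassoc (x * u * t * ((y * Db) * Da * Db * Da)); rewrite yDb.
reassoc (x * u * t * (Da * Db * Da) - x * u * t * (Rb * (Da * Db * Da))).
rewrite -xut.
have -> : x * u * t * (Da * Db * Da) = u * t * (x * Da) * Db * Da.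
  by rewrite xutC; ncring.
rewrite xDa.
have e1 : t * (y * Db) * Da = t * Da - Rb * (x * Da) by rewrite yDb mulrA Rbx; ncring.
have -> : u * t * (1 - Ra) * Db * Da = u * t * Db * Da - Ra * (t * (y * Db) * Da).
  reassoc (u * t * Db * Da - u * (t * Ra) * Db * Da); rewrite -Rat.
  reassoc (u * t * Db * Da - (u * Ra) * t * Db * Da); rewrite -Ray.
  reassoc (u * t * Db * Da - Ra * (y * t) * Db * Da); rewrite yt; ncring.
rewrite e1 xDa.
have e3 : (1 - Rb) * (u * t * Db * Da) = (1 - Rb) * (u * Da + u * Da).
  reassoc (u * t * Db * Da - (Rb * u) * t * Db * Da); rewrite Rbu.
  reassoc (u * t * Db * Da - u * (Rb * t) * Db * Da); rewrite Rbt.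
  reassoc (u * (t * Db - x * (Rb * Db)) * Da); rewrite eyD2.
  reassoc (u * Da + u * Da - (u * Rb + u * Rb) * Da); rewrite -Rbu; ncring.
reassoc ((1 - Rb) * (u * t * Db * Da) - (1 - Rb) * ((Ra * t) * Da)
  + (1 - Rb) * Ra * Rb * (1 - Ra)); rewrite e3 Rat.
reassoc ((1 - Rb) * (u * Da + u * Da - t * (Ra * Da)) + (1 - Rb) * Ra * Rb * (1 - Ra)).
by rewrite RaD exD2; ncring.
Qed.

End DividedDifferences.

(** * Yang-Baxter equations in types A_2 and B_2 *)

Section YangBaxter.
Context (A : pzRingType) (a b x y : A).
Hypotheses (ax : a * x = x * a) (ay : a * y = y * a)
  (bx : b * x = x * b) (bY : b * y = y * b) (xy : x * y = y * x).

(** The hypotheses on [1 - z * a] and [1 - z * b] absorb the terms in which one generator occurs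
    twice in a row; the braid relation then matches the cubic terms. *)
Lemma yang_baxter3 (z : A) : a * b * a = b * a * b ->
  a * z = z * a -> b * z = z * b -> x * z = z * x -> y * z = z * y ->
  (1 - x * a) * (1 - y * a) = 1 - z * a -> (1 - y * b) * (1 - x * b) = 1 - z * b ->
  (1 - x * a) * (1 - z * b) * (1 - y * a) = (1 - y * b) * (1 - z * a) * (1 - x * b).
Proof.
move=> aba az bz xz yz ha hb.
reassoc ((1 - x * a) * (1 - y * a) - z * b + x * (a * z) * b + z * (b * y) * a
  - x * (a * z) * (b * y) * a).
rewrite ha az bY; reassoc (1 - z * a - z * b + x * z * a * b + z * y * b * a
  - x * z * (a * y) * b * a); rewrite ay.
reassoc (1 - z * a - z * b + x * z * a * b + z * y * b * a - x * z * y * (a * b * a)).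
symmetry.
reassoc ((1 - y * b) * (1 - x * b) - z * a + y * (b * z) * a + z * (a * x) * b
  - y * (b * z) * (a * x) * b).
rewrite hb bz ax; reassoc (1 - z * b - z * a + y * z * b * a + z * x * a * b
  - y * z * (b * x) * a * b); rewrite bx.
reassoc (1 - z * b - z * a + y * z * b * a + z * x * a * b - y * z * x * (b * a * b)).
have -> : y * z * x = x * z * y by rewrite -mulrA -xz mulrA -xy -mulrA yz mulrA.
by rewrite -aba -xz yz; ncring.
Qed.

(** The weights run through the positive roots in a convex order and in its reverse. Expanding by
    degree, the quadratic terms agree by an identity between weights, the cubic ones because the
    weights commute, the quartic one by the braid relation. *)
Lemma yang_baxter4 : a * b * a * b = b * a * b * a -> a * a = 0 -> b * b = 0 ->
  (1 - x * a) * (1 - (x + y) * b) * (1 - (x + y + y) * a) * (1 - y * b)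
  = (1 - y * b) * (1 - (x + y + y) * a) * (1 - (x + y) * b) * (1 - x * a).
Proof.
move=> abab aa bb; pose u := x + y; pose t := x + y + y; rewrite -/u -/t.
have au : a * u = u * a by rewrite mulrDr mulrDl ax ay.
have bu : b * u = u * b by rewrite mulrDr mulrDl bx bY.
have at_ : a * t = t * a by rewrite mulrDr mulrDl au ay.
have bt : b * t = t * b by rewrite mulrDr mulrDl bu bY.
have xu : x * u = u * x by rewrite mulrDr mulrDl xy.
have yu : y * u = u * y by rewrite mulrDr mulrDl xy.
have xt : x * t = t * x by rewrite mulrDr mulrDl xu xy.
have yt : y * t = t * y by rewrite mulrDr mulrDl yu.
have ut : u * t = t * u by rewrite mulrDl xt yt -mulrDr.
have C (p q c d : A) : c * q = q * c -> (p * c) * (q * d) = (p * q) * (c * d).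
  by move=> cq; rewrite -mulrA (mulrA c) cq !mulrA.
have C3 (p q r c d e : A) : c * q = q * c -> c * r = r * c -> d * r = r * d ->
    (p * c) * (q * d) * (r * e) = (p * q * r) * (c * d * e).
  move=> cq cr dr; rewrite (C p q c d cq); apply: C.
  by rewrite -mulrA dr mulrA cr mulrA.
have C4 (p q r o c d e f : A) : c * q = q * c -> c * r = r * c -> d * r = r * d ->
    c * o = o * c -> d * o = o * d -> e * o = o * e ->
    (p * c) * (q * d) * (r * e) * (o * f) = (p * q * r * o) * (c * d * e * f).
  move=> cq cr dr co dO eo; rewrite (C3 p q r c d e cq cr dr); apply: C.
  by rewrite -mulrA eo mulrA -(mulrA c) dO mulrA co !mulrA.
have exut : x * u * t = t * u * x by rewrite -mulrA ut mulrA xt -mulrA xu mulrA.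
have eyut : u * t * y = y * t * u by rewrite -mulrA -yt mulrA -yu -mulrA ut mulrA.
set X1 := x * a; set Y1 := u * b; set X2 := t * a; set Y2 := y * b.
have X12 : X1 * X2 = 0 by rewrite C // aa mulr0.
have X21 : X2 * X1 = 0 by rewrite C // aa mulr0.
have Y12 : Y1 * Y2 = 0 by rewrite C // bb mulr0.
have Y21 : Y2 * Y1 = 0 by rewrite C // bb mulr0.
(* The identity between weights is [x u + x y + t y = t u]; [eba] is its counterpart for [b * a]. *)
have eab : X1 * Y1 + X1 * Y2 + X2 * Y2 = X2 * Y1.
  rewrite (C _ _ _ _ au) (C _ _ _ _ ay) (C _ _ _ _ ay) (C _ _ _ _ au) -!mulrDl; congr (_ * _).
  have -> : t * u = x * x + x * y + y * x + y * x + y * y + y * y by rewrite /t /u; ncring.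
  by rewrite -xy /t /u; ncring.
have eba : Y2 * X2 + Y2 * X1 + Y1 * X1 = Y1 * X2.
  rewrite (C _ _ _ _ bt) (C _ _ _ _ bx) (C _ _ _ _ bx) (C _ _ _ _ bt) -!mulrDl; congr (_ * _).
  have -> : u * t = x * x + x * y + x * y + y * x + y * y + y * y by rewrite /t /u; ncring.
  by rewrite xy /t /u; ncring.
have eaba : X1 * Y1 * X2 = X2 * Y1 * X1.
  by rewrite (C3 x u t a b a) // (C3 t u x a b a) // exut.
have ebab : Y1 * X2 * Y2 = Y2 * X2 * Y1.
  by rewrite (C3 u t y b a b) // (C3 y t u b a b) // eyut.
have eabab : X1 * Y1 * X2 * Y2 = Y2 * X2 * Y1 * X1.
  rewrite (C4 x u t y a b a b) // (C4 y t u x b a b a) // abab; congr (_ * _).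
  by rewrite exut -eyut ut -mulrA xy mulrA.
reassoc (1 - X1 - Y1 - X2 - Y2 + (X1 * Y1 + X1 * Y2 + X2 * Y2) + X1 * X2
  + Y1 * X2 + Y1 * Y2 - X1 * Y1 * X2 - X1 * (Y1 * Y2) - X1 * X2 * Y2
  - Y1 * X2 * Y2 + X1 * Y1 * X2 * Y2).
rewrite eab X12 Y12 eabab eaba ebab -eba.
symmetry.
reassoc (1 - X1 - Y1 - X2 - Y2 + X2 * Y1 + X2 * X1
  + (Y2 * X2 + Y2 * X1 + Y1 * X1) + Y2 * Y1 - X2 * Y1 * X1 - Y2 * Y1 * X1 - Y2 * (X2 * X1)
  - Y2 * X2 * Y1 + Y2 * X2 * Y1 * X1).
by rewrite X21 Y21; ncring.
Qed.

End YangBaxter.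

(** * Reduced words in the Weyl group *)

Section WeylGroup.
Context (n : nat) (I : finType) (D : root_datum n I).
Implicit Types (i j k : I) (P Q : seq I) (v w : weyl D).

Local Notation "w *> i" := (weylM w (srefl D i)) (at level 40, left associativity).
Local Notation root := (sroot D).

Lemma mul_scalar_col m (a : 'cV[int]_m) (c : 'M[int]_1) : a *m c = c 0 0 *: a.
Proof. by rewrite {1}[c]mx11_scalar mul_mx_scalar. Qed.

Lemma cartan_diag i : cartan D i i = 2.
Proof. exact: pairing_diag. Qed.

Lemma reflmx_root i j : reflmx D i *m root j = root j - cartan D i j *: root i.
Proof. exact: reflmxE. Qed.

Lemma reflmxK i : reflmx D i * reflmx D i = 1.
Proof.
have e : (root i *m scoroot D i) *m (root i *m scoroot D i)
         = 2 *: (root i *m scoroot D i).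
  rewrite mulmxA -[X in X *m _]mulmxA mul_scalar_col -/(pairing _ _).
  by rewrite -/(cartan D i i) cartan_diag scalemxAl.
rewrite /reflmx mulrBl mul1r mulrBr mulr1 -[X in _ - (_ - X)]/(_ *m _) e.
by rewrite scaler_nat mulr2n opprB addrK subrK.
Qed.

(** Sylvester's identity det (1 - a c) = det (1 - c a), from two triangular factorizations of one
    block matrix; here c a = 2. *)
Lemma det_reflmx i : \det (reflmx D i) = -1.
Proof.
pose c := scoroot D i; pose a := root i.
have h1 : block_mx 1%:M c 0 1%:M *m block_mx (1%:M - c *m a) 0 a 1%:M
          = block_mx 1%:M c a 1%:M :> 'M[int]_(1 + n).
  by rewrite mulmx_block !mul1mx !mul0mx !mulmx1 subrK !add0r.
have h2 : block_mx 1%:M 0 a 1%:M *m block_mx 1%:M c 0 (1%:M - a *m c)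
          = block_mx 1%:M c a 1%:M :> 'M[int]_(1 + n).
  by rewrite mulmx_block !mul1mx !mulmx1 !mul0mx !addr0 addrC subrK.
move: (congr1 determinant h1); rewrite -h2 !det_mulmx !det_ublock !det_lblock.
rewrite !det1 !mulr1 !mul1r => e; rewrite /reflmx -/a -/c -[1]/(1%:M) -e.
rewrite [c *m a]mx11_scalar -/(pairing c a) pairing_diag.
by rewrite -[1%:M]/(1 : 'M_1) -rmorphB det_scalar expr1.
Qed.

Lemma wordmx_cat P Q : wordmx D (P ++ Q) = wordmx D P * wordmx D Q.
Proof. exact: big_cat. Qed.

Lemma wordmx_rcons P i : wordmx D (rcons P i) = wordmx D P * reflmx D i.
Proof. by rewrite -cats1 wordmx_cat /wordmx big_seq1. Qed.

Lemma wordmx_cons i P : wordmx D (i :: P) = reflmx D i * wordmx D P.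
Proof. exact: big_cons. Qed.

Lemma wordmx1 i : wordmx D [:: i] = reflmx D i.
Proof. exact: big_seq1. Qed.

Lemma wordmx_revK P : wordmx D P * wordmx D (rev P) = 1.
Proof.
elim/last_ind: P => [|P i IH]; first by rewrite /wordmx big_nil mulr1.
by rewrite rev_rcons wordmx_rcons wordmx_cons -mulrA (mulrA (reflmx D i)) reflmxK mul1r.
Qed.

Lemma wordmx_revVK P : wordmx D (rev P) * wordmx D P = 1.
Proof. by rewrite -{2}[P]revK wordmx_revK. Qed.

Lemma det_wordmx P : \det (wordmx D P) = (-1) ^+ size P.
Proof.
elim: P => [|i P IH]; first by rewrite /wordmx big_nil det1.
by rewrite wordmx_cons det_mulmx IH det_reflmx exprS.
Qed.

Lemma weyl_inj v w : wmx v = wmx w -> v = w.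
Proof. exact: val_inj. Qed.

Lemma wmx_refl w i : wmx (w *> i) = wmx w * reflmx D i.
Proof. by rewrite /= wordmx1. Qed.

Lemma weylK w i : w *> i *> i = w.
Proof. by apply: weyl_inj; rewrite !wmx_refl -mulrA reflmxK mulr1. Qed.

Lemma word_elt_rcons P i : word_elt D (rcons P i) = word_elt D P *> i.
Proof. by apply: weyl_inj; rewrite wmx_refl /= wordmx_rcons. Qed.

Lemma wlen_word Q : (wlen (word_elt D Q) <= size Q)%N.
Proof.
rewrite /wlen; case: ex_minnP => m _; apply.
by apply/existsP; exists (in_tuple Q); apply/eqP.
Qed.

Lemma reduced_ex w : exists Q, reduced_word w Q.
Proof.
rewrite /reduced_word /wlen; case: ex_minnP => m /existsP[Q /eqP Qw] _.
by exists Q; rewrite size_tuple.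
Qed.

Lemma wlen_cat v w Q : wmx w = wmx v * wordmx D Q -> (wlen w <= wlen v + size Q)%N.
Proof.
move=> wv; have [P [Pv <-]] := reduced_ex v.
have -> : w = word_elt D (P ++ Q).
  by apply: weyl_inj; rewrite wv -Pv /= wordmx_cat.
by rewrite -size_cat wlen_word.
Qed.

Lemma det_wmx w : \det (wmx w) = (-1) ^+ wlen w.
Proof. by have [P [Pv <-]] := reduced_ex w; rewrite -det_wordmx -Pv. Qed.

(** The determinant is the sign character, so a simple reflection changes the parity of the length;
    with [wlen_refl_le] the length then changes by exactly one. *)
Lemma odd_wlen_refl w i : odd (wlen (w *> i)) = ~~ odd (wlen w).
Proof.
have := det_wmx (w *> i); rewrite wmx_refl det_mulmx det_reflmx det_wmx.
rewrite -[RHS]signr_odd -[in LHS]signr_odd.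
by rewrite mulrN1 -signrN => /signr_inj <-.
Qed.

Lemma wlen_refl_le w i : (wlen (w *> i) <= (wlen w).+1)%N.
Proof. by rewrite -addn1; apply: (@wlen_cat _ _ [:: i]); rewrite wmx_refl wordmx1. Qed.

Local Opaque wlen word_elt weylM.

Lemma ascendsP w i : ascends w i -> wlen (w *> i) = (wlen w).+1.
Proof. exact: eqP. Qed.

Lemma descendsP w i : ~~ ascends w i -> wlen w = (wlen (w *> i)).+1.
Proof.
move=> nw; have := wlen_refl_le w i; have := wlen_refl_le (w *> i) i.
rewrite weylK; have := odd_wlen_refl w i; move: nw; rewrite /ascends;
move: (wlen _) (wlen w) => a b; lia.
Qed.

Lemma ascends_refl w i : ascends (w *> i) i = ~~ ascends w i.
Proof.
rewrite {1}/ascends weylK; case: (boolP (ascends w i)) => [/ascendsP|/descendsP] e; lia.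
Qed.

Lemma ascends_wlen_lt w i : (wlen w < wlen (w *> i))%N = ascends w i.
Proof. by case: (boolP (ascends w i)) => [/ascendsP|/descendsP] e; lia. Qed.

Lemma wlen1 : wlen (weyl1 D) = 0%N.
Proof. by apply/eqP; rewrite -leqn0 (wlen_word [::]). Qed.

Lemma reduced_rcons w P i : reduced_word w (rcons P i) ->
  [/\ ~~ ascends w i, reduced_word (w *> i) P & w = word_elt D P *> i].
Proof.
case=> Pw szw; have Pe : word_elt D P = w *> i by rewrite -Pw word_elt_rcons weylK.
have le := wlen_word P; rewrite Pe in le; rewrite size_rcons in szw.
have na : ~~ ascends w i by rewrite -ascends_wlen_lt -leqNgt; lia.
split=> //; last by rewrite Pe weylK.
by split=> //; apply: succn_inj; rewrite szw (descendsP na).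
Qed.

Lemma rcons_reduced w P i : ~~ ascends w i -> reduced_word (w *> i) P ->
  reduced_word w (rcons P i).
Proof.
move=> na [Pw szP]; split; first by rewrite word_elt_rcons Pw weylK.
by rewrite size_rcons szP -descendsP.
Qed.

Lemma descent_ex w : wlen w != 0%N -> exists i, ~~ ascends w i.
Proof.
have [Q] := reduced_ex w; case/lastP: Q => [[_ <-] //|P i] rw _.
by exists i; have [] := reduced_rcons rw.
Qed.

Lemma wlen_eq0 w : wlen w = 0%N -> w = weyl1 D.
Proof. by have [Q [<- <-]] := reduced_ex w; move/size0nil->. Qed.

(** Membership in the cone of the simple roots: [x] need not be a root, and 0 is included. *)
Definition posroot (x : 'cV[int]_n) : Prop :=
  exists c : I -> nat, x = \sum_i (c i)%:Z *: root i.

Lemma posroot_root i : posroot (root i).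
Proof.
exists (fun j => (j == i) : nat); rewrite (bigD1 i) //= eqxx scale1r big1 ?addr0 //.
by move=> j /negbTE ->; rewrite scale0r.
Qed.

Lemma posrootD x y : posroot x -> posroot y -> posroot (x + y).
Proof.
move=> [c ->] [d ->]; exists (fun i => (c i + d i)%N).
by rewrite -big_split; apply: eq_bigr => i _; rewrite PoszD scalerDl.
Qed.

Lemma posrootZ (a : int) x : 0 <= a -> posroot x -> posroot (a *: x).
Proof.
case: a => // m _ [c ->]; exists (fun i => (m * c i)%N).
by rewrite scaler_sumr; apply: eq_bigr => i _; rewrite scalerA PoszM.
Qed.

Lemma root_coefP (c d : I -> int) :
  \sum_i c i *: root i = \sum_i d i *: root i -> c =1 d.
Proof.
move=> e i; apply/eqP; rewrite -subr_eq0; apply/eqP.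
apply: (sroot_free (r := D) (c := fun i => c i - d i)) => //.
under eq_bigr do rewrite scalerBl.
by rewrite sumrB e subrr.
Qed.

Lemma root_sum (a : int) i : a *: root i = \sum_j (a *+ (j == i)) *: root j.
Proof.
rewrite (bigD1 i) //= eqxx big1 ?addr0 // => j /negbTE ->.
by rewrite scale0r.
Qed.

Lemma cartan_le0 i j : i != j -> cartan D i j <= 0.
Proof. exact: pairing_offdiag. Qed.

Lemma reflmx_inj : injective (reflmx D).
Proof.
move=> i j e; apply/eqP; apply: contraT => ne.
have := congr1 (fun M => M *m root i) e; rewrite !reflmx_root cartan_diag.
move/(congr1 (fun x => root i - x)); rewrite !subKr !root_sum => /root_coefP/(_ i).
by rewrite eqxx (negbTE ne).
Qed.

End WeylGroup.

(** * Braid relations for involutions of the form 1 - X *)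

Section RingInvolutions.
Context (R : pzRingType) (X Y : R).
Hypotheses (XX : X * X = X + X) (YY : Y * Y = Y + Y).

Lemma involutions_comm : X * Y = Y * X -> (1 - X) * (1 - Y) = (1 - Y) * (1 - X).
Proof.
move=> XY; have -> : (1 - X) * (1 - Y) = 1 - X - Y + X * Y by ncring.
by rewrite XY; ncring.
Qed.

Lemma involutions_braid3 : X * Y * X = X -> Y * X * Y = Y ->
  (1 - X) * (1 - Y) * (1 - X) = (1 - Y) * (1 - X) * (1 - Y).
Proof.
move=> XYX YXY.
have -> : (1 - X) * (1 - Y) * (1 - X)
  = 1 - X - X + X * X - Y + X * Y + Y * X - X * Y * X by ncring.
have -> : (1 - Y) * (1 - X) * (1 - Y)
  = 1 - Y - Y + Y * Y - X + X * Y + Y * X - Y * X * Y by ncring.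
by rewrite XYX YXY XX YY; ncring.
Qed.

Lemma involutions_braid4 : X * Y * X = X + X -> Y * X * Y = Y + Y ->
  (1 - X) * (1 - Y) * (1 - X) * (1 - Y) = (1 - Y) * (1 - X) * (1 - Y) * (1 - X).
Proof.
move=> XYX YXY.
have -> : (1 - Y) * (1 - X) * (1 - Y) * (1 - X) = (1 - Y) * ((1 - X) * (1 - Y) * (1 - X)).
  by rewrite !mulrA.
have -> : (1 - X) * (1 - Y) * (1 - X)
  = 1 - X - X + X * X - Y + X * Y + Y * X - X * Y * X by ncring.
rewrite XYX XX.
have -> : (1 - X - X + (X + X) - Y + X * Y + Y * X - (X + X)) * (1 - Y)
 = 1 - X - X + X * Y + X * Y - Y + X * Y + Y * X - Y + Y * Y - X * (Y * Y) - Y * X * Y by ncring.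
have -> : (1 - Y) * (1 - X - X + (X + X) - Y + X * Y + Y * X - (X + X))
 = 1 - X - X + Y * X + Y * X - Y + X * Y + Y * X - Y + Y * Y - (Y * Y) * X - Y * X * Y by ncring.
by rewrite YXY YY; ncring.
Qed.

End RingInvolutions.

(** * Braid relations in the Weyl group, and positivity at ascents *)

Section PositiveRoots.
Context (n : nat) (I : finType) (D : root_datum n I).
Implicit Types (i j k : I) (P Q : seq I) (v w : weyl D).

Local Notation "w *> i" := (weylM w (srefl D i)) (at level 40, left associativity).
Local Notation root := (sroot D).
Local Opaque wlen word_elt weylM.

Let E i : 'M[int]_n := root i *m scoroot D i.

Let EM i j : E i * E j = cartan D i j *: (root i *m scoroot D j).
Proof.
rewrite -[LHS]/(_ *m _) mulmxA -[X in X *m _]mulmxA mul_scalar_col.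
by rewrite scalemxAl.
Qed.

(** [E i] has rank one, so sandwiching between two copies of it gives a scalar multiple, by 1 in
    type A_2 and by 2 in type B_2. *)
Let EMM i j : E i * E j * E i = (cartan D i j * cartan D j i) *: E i.
Proof.
rewrite EM -[LHS]/(_ *m _) -scalemxAl -scalerA; congr (_ *: _).
rewrite /E mulmxA -[X in X *m _]mulmxA mul_scalar_col.
by rewrite -scalemxAl.
Qed.

Let EE i : E i * E i = E i + E i.
Proof. by rewrite EM cartan_diag -mulr2n -scaler_nat. Qed.

Lemma reflmx_comm i j : orthogonal_roots D i j ->
  reflmx D i * reflmx D j = reflmx D j * reflmx D i.
Proof.
by move=> [cij cji]; apply: involutions_comm; rewrite !EM cij cji !scale0r.
Qed.

Lemma reflmx_braid3 i j : span_A2 D i j ->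
  reflmx D i * reflmx D j * reflmx D i = reflmx D j * reflmx D i * reflmx D j.
Proof.
move=> [cij cji]; apply: involutions_braid3; rewrite -/(E _) -/(E _) ?EE //.
  by rewrite EMM cij cji mulN1r opprK scale1r.
by rewrite EMM cij cji mulN1r opprK scale1r.
Qed.

Lemma reflmx_braid4 i j : span_B2 D i j ->
  reflmx D i * reflmx D j * reflmx D i * reflmx D j
  = reflmx D j * reflmx D i * reflmx D j * reflmx D i.
Proof.
move=> cc; have c2 : cartan D i j * cartan D j i = 2.
  by case: cc => [[-> ->]|[-> ->]].
apply: involutions_braid4; rewrite -/(E _) -/(E _) ?EE //.
  by rewrite EMM c2 -mulr2n -scaler_nat.
by rewrite EMM mulrC c2 -mulr2n -scaler_nat.
Qed.

Lemma wmx_refl_root w i (x : 'cV[int]_n) :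
  wmx (w *> i) *m x = wmx w *m (reflmx D i *m x).
Proof. by rewrite wmx_refl -mulmxA. Qed.

Lemma orthogonal_roots_sym i j : orthogonal_roots D i j -> orthogonal_roots D j i.
Proof. by case. Qed.
Lemma span_A2_sym i j : span_A2 D i j -> span_A2 D j i.
Proof. by case. Qed.

Lemma weyl_comm w i j : orthogonal_roots D i j -> w *> i *> j = w *> j *> i.
Proof.
by move=> o; apply: weyl_inj; rewrite !wmx_refl -!mulrA reflmx_comm.
Qed.

Lemma weyl_braid3 w i j : span_A2 D i j -> w *> i *> j *> i = w *> j *> i *> j.
Proof.
move=> s; apply: weyl_inj; rewrite !wmx_refl -!mulrA.
by have := reflmx_braid3 s; rewrite -!mulrA => ->.
Qed.

Lemma weyl_braid4 w i j : span_B2 D i j ->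
  w *> i *> j *> i *> j = w *> j *> i *> j *> i.
Proof.
move=> s; apply: weyl_inj; rewrite !wmx_refl -!mulrA.
by have := reflmx_braid4 s; rewrite -!mulrA => ->.
Qed.

Lemma reflmx_reflmx_root i j : reflmx D i *m (reflmx D j *m root i)
  = (cartan D j i * cartan D i j - 1) *: root i + (- cartan D j i) *: root j.
Proof.
rewrite reflmx_root mulmxBr -scalemxAr !reflmx_root cartan_diag.
by apply/matrixP => a b; rewrite !mxE; ring.
Qed.

Hypothesis lacedD : doubly_laced D.

(* Letters j, i, j, ... are removed from the right end of w as long as they are
   descents, leaving w = v u with u in the dihedral group of i and j: either both
   v (root i) and v (root j) are positive by induction and u (root i) is a
   nonnegative combination of root i and root j, or u is long enough for a braid
   relation to contradict the length of w *> i. *)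
Lemma ascends_posroot w i : ascends w i -> posroot D (wmx w *m root i).
Proof.
have [m] := ubnP (wlen w); elim: m w i => // m IH w i.
rewrite ltnS => le_wm ai.
have [w0|w_neq1] := eqVneq (wlen w) 0%N.
  rewrite (wlen_eq0 w0) [wmx _]big_nil mul1mx; exact: posroot_root.
have [j dj] := descent_ex w_neq1.
have ne_ij : i != j by apply: contraNneq dj => <-.
have cji_le0 : 0 <= - cartan D j i by rewrite oppr_ge0 cartan_le0 // eq_sym.
pose w1 := w *> j; have w1K : w = w1 *> j by rewrite weylK.
have a1 : ascends w1 j by rewrite ascends_refl.
have l1 : wlen w = (wlen w1).+1 by rewrite (descendsP dj).
clearbody w1.
have lwi := ascendsP ai.
have [a1i|d1i] := boolP (ascends w1 i).
  rewrite w1K wmx_refl_root reflmx_root mulmxBr -scalemxAr -scaleNr.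
  by apply: posrootD; [|apply: posrootZ => //]; apply: IH => //; rewrite -ltnS -l1.
pose w2 := w1 *> i; have w2K : w1 = w2 *> i by rewrite weylK.
have a2 : ascends w2 i by rewrite ascends_refl.
have l2 : wlen w1 = (wlen w2).+1 by rewrite (descendsP d1i).
clearbody w2.
have p2 : posroot D (wmx w2 *m root i) by apply: IH => //; lia.
(* Commutation would cancel two letters: [w *> i] would have length at most [wlen w2 + 1], whereas
   it is [wlen w2 + 3]. The other braid relations are used in the same way. *)
have no_orth : orthogonal_roots D i j -> False.
  move=> o; have e : w *> i = w2 *> j.
    by rewrite w1K w2K (weyl_comm w2 o) weylK.
  by have := wlen_refl_le w2 j; rewrite -e; lia.
have [a2j|d2j] := boolP (ascends w2 j).
  have p2j : posroot D (wmx w2 *m root j) by apply: IH => //; lia.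
  rewrite w1K w2K !wmx_refl_root reflmx_reflmx_root mulmxDr -!scalemxAr.
  apply: posrootD; apply: posrootZ => //.
  case: (lacedD ne_ij) => [/no_orth //|[-> ->] //|].
  by case=> [[-> ->]|[-> ->]].
pose w3 := w2 *> j; have w3K : w2 = w3 *> j by rewrite weylK.
have a3 : ascends w3 j by rewrite ascends_refl.
have l3 : wlen w2 = (wlen w3).+1 by rewrite (descendsP d2j).
clearbody w3.
case: (lacedD ne_ij) => [/no_orth //|s|s].
  have e : w *> i = w3 *> i *> j.
    by rewrite w1K w2K w3K (weyl_braid3 _ (span_A2_sym s)) weylK.
  by have := wlen_refl_le (w3 *> i) j; have := wlen_refl_le w3 i; rewrite -e; lia.
have [a3i|d3i] := boolP (ascends w3 i).
  (* The product s_j s_i s_j is the reflection in s_j (root i), which is orthogonal to root i in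
     type B_2, so it fixes root i. *)
  have -> : wmx w *m root i = wmx w3 *m root i.
    rewrite w1K w2K w3K !wmx_refl_root; congr (_ *m _).
    have c2 : cartan D i j * cartan D j i = 2 by case: s => [[-> ->]|[-> ->]].
    rewrite reflmx_reflmx_root mulmxDr -!scalemxAr !reflmx_root cartan_diag mulrC c2.
    by apply/matrixP => a b; rewrite !mxE; ring.
  by apply: IH => //; lia.
pose w4 := w3 *> i; have w4K : w3 = w4 *> i by rewrite weylK.
have l4 : wlen w3 = (wlen w4).+1 by rewrite (descendsP d3i).
clearbody w4.
have e : w *> i = w4 *> j *> i *> j.
  by rewrite w1K w2K w3K w4K (weyl_braid4 _ s) weylK.
have := wlen_refl_le (w4 *> j *> i) j; have := wlen_refl_le (w4 *> j) i.
by have := wlen_refl_le w4 j; rewrite -e; lia.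
Qed.

End PositiveRoots.

(** * The exchange condition, Matsumoto's theorem and Demazure products *)

Section ReducedWords.
Context (n : nat) (I : finType) (D : root_datum n I).
Implicit Types (i j k : I) (P Q : seq I) (v w : weyl D).

Local Notation "w *> i" := (weylM w (srefl D i)) (at level 40, left associativity).
Local Notation root := (sroot D).
Local Opaque wlen word_elt weylM.

Lemma wmx_word P : wmx (word_elt D P) = wordmx D P.
Proof. by []. Qed.

Lemma reflmx_self i : reflmx D i *m root i = - root i.
Proof.
by rewrite reflmx_root cartan_diag scaler_nat mulr2n opprD addrA subrr sub0r.
Qed.

Lemma wordmx_nil : wordmx D [::] = 1.
Proof. exact: big_nil. Qed.

Hypothesis lacedD : doubly_laced D.

Lemma descends_negroot w i : ~~ ascends w i -> posroot D (- (wmx w *m root i)).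
Proof.
rewrite -ascends_refl => /(ascends_posroot lacedD).
by rewrite wmx_refl_root reflmx_self mulmxN.
Qed.

Lemma posrootN_eq0 x : posroot D x -> posroot D (- x) -> x = 0.
Proof.
move=> [c xc] [d xd]; rewrite xc big1 // => i _.
have : \sum_i (c i + d i)%:Z *: root i = \sum_i 0 *: root i.
  under eq_bigr do rewrite PoszD scalerDl.
  by rewrite big_split /= -xc -xd subrr big1 // => j _; rewrite scale0r.
move/root_coefP/(_ i) => /= cd; have ci : c i = 0%N by lia.
by rewrite ci scale0r.
Qed.

Lemma wordmx_root_neq0 Q i : wordmx D Q *m root i != 0.
Proof.
apply/eqP => e; have := sroot_neq0 D i; rewrite -[root i]mul1mx.
rewrite -[1%:M]/(1 : 'M_n) -(wordmx_revVK D Q) -[_ * _]/(_ *m _).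
by rewrite -mulmxA e mulmx0 eqxx.
Qed.

Lemma descendsE w i : ~~ ascends w i <-> posroot D (- (wmx w *m root i)).
Proof.
split; first exact: descends_negroot.
move=> nw; apply/negP => /(ascends_posroot lacedD) pw.
have [Q [Qw _]] := reduced_ex w.
by have := wordmx_root_neq0 Q i; rewrite -wmx_word Qw (posrootN_eq0 pw nw) eqxx.
Qed.

Lemma weyl_pos_eq1 w : (forall i, posroot D (wmx w *m root i)) -> w = weyl1 D.
Proof.
move=> pw; apply: wlen_eq0; apply/eqP; apply: contraT => /descent_ex[i].
move/descendsE => nw; have [Q [Qw _]] := reduced_ex w.
by have := wordmx_root_neq0 Q i; rewrite -wmx_word Qw (posrootN_eq0 (pw i) nw) eqxx.
Qed.

(* Q s_i Q^-1 s_k fixes root k and moves every vector by a multiple of root k,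
   hence keeps all simple roots positive, hence is trivial. *)
Lemma wordmx_root_refl Q i k : wordmx D Q *m root i = root k ->
  wordmx D Q * reflmx D i = reflmx D k * wordmx D Q.
Proof.
move=> Qik; pose P := Q ++ i :: rcons (rev Q) k.
have PE : wordmx D P = wordmx D Q * reflmx D i * wordmx D (rev Q) * reflmx D k.
  by rewrite wordmx_cat wordmx_cons wordmx_rcons !mulrA.
have Pshift x : exists m, wordmx D P *m x = x + m *: root k.
  rewrite PE -!mulmxE -!mulmxA reflmxE.
  rewrite mulmxBr [wordmx D Q *m (_ *m _)]mulmxA mulmxE wordmx_revK mul1mx -scalemxAr Qik reflmxE.
  by rewrite -!scaleNr -addrA -scalerDl; eexists.
have P1 : word_elt D P = weyl1 D.
  apply: weyl_pos_eq1 => j; rewrite wmx_word.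
  have [->|ne_jk] := eqVneq j k.
    have Qki : wordmx D (rev Q) *m root k = root i.
      by rewrite -Qik mulmxA mulmxE wordmx_revVK mul1mx.
    rewrite PE -!mulmxE -!mulmxA reflmx_self !mulmxN Qki reflmx_self.
    by rewrite mulmxN opprK Qik; exact: posroot_root.
  (* The image root j + m root k with j distinct from k has coefficient 1 at root j, so it cannot be
     negative. *)
  have [/(ascends_posroot lacedD)//|/descends_negroot] := boolP (ascends (word_elt D P) j).
  rewrite wmx_word; have [m ->] := Pshift (root j).
  case=> c /(congr1 -%R); rewrite opprK -sumrN.
  under [RHS]eq_bigr do rewrite -scaleNr.
  rewrite -[root j]scale1r !root_sum -big_split /=.
  under eq_bigr do rewrite -scalerDl.
  move/root_coefP/(_ j) => /=; rewrite eqxx (negbTE ne_jk) => e.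
  by exfalso; lia.
have := congr1 (@wmx _ _ _) P1; rewrite wmx_word PE [RHS]big_nil.
move/(congr1 (fun M => M * reflmx D k * wordmx D Q)).
by rewrite mul1r -2!mulrA (mulrA (reflmx D k)) reflmxK mul1r -mulrA wordmx_revVK mulr1.
Qed.

(** Reading the word from its right end, root i turns from positive to negative at some letter k. A
    simple reflection s_k can do this only to root k, so the suffix Q maps root i to root k, and Q
    s_i = s_k Q cancels the letter k. *)
Lemma exchange Q i : ~~ ascends (word_elt D Q) i ->
  exists Q1 k Q2, Q = Q1 ++ k :: Q2 /\ wordmx D (Q1 ++ Q2) = wordmx D Q * reflmx D i.
Proof.
elim: Q => [|k Q IH] dQ.
  have [c] := descends_negroot dQ; rewrite wmx_word [wordmx _ _]big_nil mul1mx.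
  move=> e; have := posrootN_eq0 (posroot_root D i) (ex_intro _ c e).
  by move/eqP; rewrite (negbTE (sroot_neq0 D i)).
have [aQ|{}/IH[Q1 [l [Q2 [-> e]]]]] := boolP (ascends (word_elt D Q) i); last first.
  by exists (k :: Q1), l, Q2; split=> //; rewrite !wordmx_cons e mulrA.
have [c Qc] := ascends_posroot lacedD aQ.
have [d Qd] := descends_negroot dQ.
rewrite !wmx_word in Qc Qd.
exists [::], k, Q; split=> //=; rewrite wordmx_cons.
suff Qk : wordmx D Q *m root i = root k.
  by rewrite -mulrA (wordmx_root_refl Qk) mulrA reflmxK mul1r.
(* The reflection s_k changes only the coefficient at root k; any other coefficient is nonnegative
   before and nonpositive after, hence 0. *)
have c0 j : j != k -> c j = 0%N.
  move=> ne_jk; move: Qd; rewrite wordmx_cons -mulmxE -mulmxA reflmxE => /(congr1 -%R).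
  rewrite opprK Qc -scaleNr root_sum -big_split -sumrN /=.
  under eq_bigr do rewrite -scalerDl.
  under [RHS]eq_bigr do rewrite -scaleNr.
  by move/root_coefP/(_ j) => /=; rewrite (negbTE ne_jk); lia.
have Qck : wordmx D Q *m root i = (c k)%:Z *: root k.
  rewrite Qc root_sum; apply: eq_bigr => j _.
  by have [->//|/c0->] := eqVneq j k.
suff ck : c k = 1%N by rewrite Qck ck scale1r.
(* The inverse of Q maps root k to an integral combination of simple roots, and [c k] times it is
   root i; so [c k] divides 1. *)
have [f fE] : exists f : I -> int, wordmx D (rev Q) *m root k = \sum_j f j *: root j.
  have [/(ascends_posroot lacedD)|/descends_negroot] := boolP (ascends (word_elt D (rev Q)) k).
    by case=> f ->; exists (fun j => (f j)%:Z).
  case=> f fE; exists (fun j => - (f j)%:Z).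
  rewrite -[LHS]opprK fE -sumrN; apply: eq_bigr => j _; exact: esym (scaleNr _ _).
have : 1 *: root i = \sum_j ((c k)%:Z * f j) *: root j.
  rewrite scale1r -[root i]mul1mx -[1%:M]/(1 : 'M_n) -(wordmx_revVK D Q) -mulmxE.
  rewrite -mulmxA Qck -scalemxAr fE scaler_sumr.
  by apply: eq_bigr => j _; rewrite scalerA.
rewrite root_sum => /root_coefP/(_ i) /=; rewrite eqxx mulr1n => e.
have : `|1 : int|%N = (c k * `|f i|)%N by rewrite e abszM.
by move/esym/eqP; rewrite muln_eq1 => /andP[/eqP].
Qed.

(** The letter deleted by the exchange lies in [P] or in [Q]. In the first case the suffix [Q]
    survives and grows by [i]; [two_descents] excludes the second case for alternating suffixes. *)
Lemma reduced_exchange w P Q i : reduced_word w (P ++ Q) -> ~~ ascends w i ->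
  (exists P', reduced_word w (P' ++ rcons Q i)) \/
  (exists Q1 k Q2, Q = Q1 ++ k :: Q2 /\ reduced_word w (P ++ rcons (Q1 ++ Q2) i)).
Proof.
move=> [Pw szP]; rewrite -Pw => /exchange[R1 [k [R2 [eR R12]]]].
have red R : R1 ++ R2 = R -> reduced_word w (rcons R i).
  move=> eR'; split; last first.
    by rewrite size_rcons -szP eR -eR' !size_cat /= addnS.
  apply: weyl_inj; rewrite wmx_word wordmx_rcons -eR' R12 -mulrA reflmxK mulr1.
  by rewrite -wmx_word Pw.
rewrite Pw; have [ltP|leP] := ltnP (size R1) (size P).
  left; exists (R1 ++ take (size P - (size R1).+1) R2).
  have := congr1 (take (size P)) eR; rewrite take_size_cat //.
  rewrite take_cat ltnNge (ltnW ltP) /=.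
  have -> : (size P - size R1 = (size P - (size R1).+1).+1)%N by lia.
  move=> eP; have := congr1 (drop (size P)) eR; rewrite drop_size_cat //.
  rewrite drop_cat ltnNge (ltnW ltP) /=.
  have -> : (size P - size R1 = (size P - (size R1).+1).+1)%N by lia.
  move=> /= eQ; rewrite -rcons_cat; apply: red.
  by rewrite -catA eQ cat_take_drop.
right; exists (drop (size P) R1), k, R2; split.
  have := congr1 (drop (size P)) eR; rewrite drop_size_cat // drop_cat.
  case: ltnP => [_ -> //|ge ->].
  have -> : size P = size R1 by apply/eqP; rewrite eqn_leq leP.
  by rewrite subnn drop_size.
rewrite -rcons_cat; apply: red; rewrite catA; congr (_ ++ _).
suff eP : P = take (size P) R1 by rewrite {1}eP cat_take_drop.
have := congr1 (take (size P)) eR; rewrite take_size_cat // take_cat.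
case: ltnP => // ge ->; have -> : size P = size R1 by apply/eqP; rewrite eqn_leq leP.
by rewrite subnn take0 cats0 take_size.
Qed.

Definition word_braided (M : pzRingType) (f : I -> M) i j :=
  [\/ orthogonal_roots D i j /\ f i * f j = f j * f i,
      span_A2 D i j /\ f i * f j * f i = f j * f i * f j
    | span_B2 D i j /\ f i * f j * f i * f j = f j * f i * f j * f i].

Lemma reduced_size w P Q : reduced_word w P -> reduced_word w Q -> size P = size Q.
Proof. by move=> [_ ->] [_ ->]. Qed.

Lemma word_eltP P Q : word_elt D P = word_elt D Q <-> wordmx D P = wordmx D Q.
Proof.
split=> [/(congr1 (@wmx _ _ _))|e]; first by rewrite !wmx_word.
by apply: weyl_inj; rewrite !wmx_word.
Qed.

Lemma wordmx_catI P Q Q' : wordmx D (P ++ Q) = wordmx D (P ++ Q') ->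
  wordmx D Q = wordmx D Q'.
Proof.
rewrite !wordmx_cat => /(congr1 (fun M => wordmx D (rev P) * M)).
by rewrite !mulrA wordmx_revVK !mul1r.
Qed.

Lemma not_reduced_pair w P i : ~ reduced_word w (P ++ [:: i; i]).
Proof.
rewrite (_ : [:: i; i] = rcons [:: i] i) // -rcons_cat => /reduced_rcons[d r _].
move: r; rewrite cats1 => /reduced_rcons[d' _ _].
by move: d'; rewrite ascends_refl d.
Qed.

Lemma not_reduced_pair1 w P i j : ~ reduced_word w (P ++ [:: i; i; j]).
Proof.
rewrite (_ : [:: i; i; j] = rcons [:: i; i] j) // -rcons_cat => /reduced_rcons[_ r _].
exact: not_reduced_pair r.
Qed.

Lemma reduced_subst w P Q Q' : size Q = size Q' -> wordmx D Q = wordmx D Q' ->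
  reduced_word w (P ++ Q) -> reduced_word w (P ++ Q').
Proof.
move=> sz e [<- eQ]; split; last by rewrite -eQ !size_cat sz.
by apply/word_eltP; rewrite !wordmx_cat e.
Qed.

(** On root i, the two orders of the product give opposite coefficients at root j. *)
Lemma reflmx_comm_cartan i j : i != j ->
  reflmx D i * reflmx D j = reflmx D j * reflmx D i -> cartan D j i = 0.
Proof.
move=> ne_ij /(congr1 (fun M => M *m root i)).
rewrite -!mulmxE -!mulmxA reflmx_reflmx_root reflmx_self mulmxN reflmx_root.
rewrite opprB -[- root i]scaleN1r !root_sum -!big_split /=.
under eq_bigr do rewrite -scalerDl.
under [RHS]eq_bigr do rewrite -scalerDl.
move/root_coefP/(_ j) => /=; rewrite eqxx eq_sym (negbTE ne_ij); lia.
Qed.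

(* Exchanging for the descents j, i, j, ... in turn makes longer and longer
   suffixes alternate between i and j. *)
Lemma two_descents w P i j : i != j -> reduced_word w (rcons P i) -> ~~ ascends w j ->
  [\/ orthogonal_roots D i j /\ exists P', reduced_word w (P' ++ [:: i; j]),
      span_A2 D i j /\ exists P', reduced_word w (P' ++ [:: i; j; i])
    | span_B2 D i j /\ exists P', reduced_word w (P' ++ [:: i; j; i; j])].
Proof.
move=> ne_ij ri dj; have [di _ _] := reduced_rcons ri.
have refl_neq : reflmx D i <> reflmx D j by move/reflmx_inj/eqP; apply/negP.
have [P1 r1] : exists P', reduced_word w (P' ++ [:: i; j]).
  move: ri; rewrite -cats1 => ri; have [//|[Q1 [k [Q2 [eQ r1]]]]] := reduced_exchange ri dj.
  (* Deleting the only letter of the suffix would give two words for [w] that differ in their last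
     letter alone, hence s_i = s_j. *)
  case: Q1 eQ r1 => [|? [|//]] [] // -> <- /= r1.
  have [ri' _] := ri; have [r1' _] := r1; move: ri'; rewrite -r1'.
  by move/word_eltP/wordmx_catI; rewrite !wordmx1 => /refl_neq.
have comm_ij : reduced_word w (P1 ++ [:: j; i]) ->
    reflmx D i * reflmx D j = reflmx D j * reflmx D i.
  have [<- _] := r1; move=> [/word_eltP/wordmx_catI e _]; move: e.
  by rewrite !wordmx_cons wordmx_nil !mulr1 => ->.
case: (lacedD ne_ij) => [o|s|s]; first by constructor 1; split=> //; exists P1.
  constructor 2; split=> //.
  have [//|[Q1 [k [Q2 [eQ r2]]]]] := reduced_exchange r1 di.
  (* Deleting i leaves the suffix j i, so that s_i and s_j commute; deleting j leaves i i, which is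
     not reduced. *)
  case: Q1 eQ r2 => [|? [|? [|//]]] [] // => [_ <-|-> _ <-] /= r2.
    by have := reflmx_comm_cartan ne_ij (comm_ij r2); case: s => _ ->.
  by case: (not_reduced_pair r2).
constructor 3; split=> //.
have not_comm : reflmx D i * reflmx D j <> reflmx D j * reflmx D i.
  by move/(reflmx_comm_cartan ne_ij) => c0; case: s; rewrite c0; case.
have [P2 r2] : exists P', reduced_word w (P' ++ [:: i; j; i]).
  have [//|[Q1 [k [Q2 [eQ r2]]]]] := reduced_exchange r1 di.
  case: Q1 eQ r2 => [|? [|? [|//]]] [] // => [_ <-|-> _ <-] /= r2.
    by case: (not_comm (comm_ij r2)).
  by case: (not_reduced_pair r2).
have [//|[Q1 [k [Q2 [eQ r3]]]]] := reduced_exchange r2 dj.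
(* Deleting the first letter gives s_i s_j s_i = s_j s_i s_j, which together with the relation of
   type B_2 forces commutation; the other deletions leave a repeated letter. *)
case: Q1 eQ r3 => [|? [|? [|? [|//]]]] [] // => [_ <-|-> _ <-|-> -> _ <-] /= r3.
- have [w3 _] := r3; have [] := r2; rewrite -w3 => /word_eltP/wordmx_catI + _.
  rewrite !wordmx_cons wordmx_nil !mulr1 => b3; case: not_comm.
  have := reflmx_braid4 s; rewrite -!mulrA -b3 mulrA reflmxK mul1r.
  by rewrite b3 mulrA reflmxK mul1r => ->.
- by case: (not_reduced_pair1 r3).
by move: r3; rewrite -cat1s catA => /not_reduced_pair.
Qed.

(** Induction on the length. If the last letters i and j differ, both are descents, and
    [two_descents] gives a reduced word ending in a side of the braid relation. Its two forms end in
    i and in j, so each is compared with [P] or [Q] by dropping the common last letter. *)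
Lemma matsumoto (M : pzRingType) (f : I -> M) :
  (forall i j, i != j -> word_braided f i j) ->
  forall w P Q, reduced_word w P -> reduced_word w Q ->
  \prod_(q <- P) f q = \prod_(q <- Q) f q.
Proof.
move=> braid w P; have [m] := ubnP (size P); elim: m w P => // m IH w P szP Q rP rQ.
case/lastP: P szP rP => [|P i] szP rP.
  by have := reduced_size rP rQ => /esym/size0nil ->.
case/lastP: Q rQ => [|Q j] rQ.
  by have := reduced_size rP rQ; rewrite size_rcons.
rewrite size_rcons ltnS in szP.
have same_last v R R' k : (size R < m)%N -> reduced_word v (rcons R k) ->
    reduced_word v (rcons R' k) ->
    \prod_(q <- rcons R k) f q = \prod_(q <- rcons R' k) f q.
  move=> szR /reduced_rcons[_ rR _] /reduced_rcons[_ rR' _].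
  by rewrite -!cats1 !big_cat /= (IH _ _ szR _ rR rR').
have [eij|ne_ij] := eqVneq i j.
  by rewrite -eij in rQ *; exact: (same_last w P Q i szP rP rQ).
have szPQ : size P = size Q.
  by have := reduced_size rP rQ; rewrite !size_rcons; exact: succn_inj.
have [dj _ _] := reduced_rcons rQ.
(* The chain is P i, R T i, R T' j, Q j, whose middle link is the braid relation. *)
have conclude R T T' : size T = size T' ->
    wordmx D (rcons T i) = wordmx D (rcons T' j) ->
    \prod_(q <- rcons T i) f q = \prod_(q <- rcons T' j) f q ->
    reduced_word w (R ++ rcons T i) ->
    \prod_(q <- rcons P i) f q = \prod_(q <- rcons Q j) f q.
  move=> szT eT fT rT.
  have rT' : reduced_word w (R ++ rcons T' j).
    by apply: reduced_subst eT rT; rewrite !size_rcons szT.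
  have e : \prod_(q <- R ++ rcons T i) f q = \prod_(q <- R ++ rcons T' j) f q.
    by rewrite !big_cat /= fT.
  rewrite -!rcons_cat in rT rT' e.
  rewrite (same_last w P (R ++ T) i) // e -(same_last w Q (R ++ T') j) //.
  by rewrite -szPQ.
have [[o [R rR]]|[s [R rR]]|[s [R rR]]] := two_descents ne_ij rP dj.
- case: (braid _ _ ne_ij) => [[_ b]|[s _]|[s _]].
  + apply: (conclude R [:: j] [:: i]) => //=.
    * by rewrite !wordmx_cons wordmx_nil !mulr1 (reflmx_comm o).
    * by rewrite !big_cons !big_nil !mulr1.
    * apply: reduced_subst rR => //.
      by rewrite !wordmx_cons wordmx_nil !mulr1 (reflmx_comm o).
  + by case: s; case: o => -> ->.
  + by case: s => -[]; case: o => -> ->.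
- case: (braid _ _ ne_ij) => [[o _]|[_ b]|[s' _]].
  + by case: s; case: o => -> ->.
  + apply: (conclude R [:: i; j] [:: j; i]) => //=.
    * by have := reflmx_braid3 s; rewrite !wordmx_cons wordmx_nil !mulr1 -!mulrA.
    * by move: b; rewrite !big_cons !big_nil !mulr1 -!mulrA.
  + by case: s' => -[]; case: s => -> ->.
- case: (braid _ _ ne_ij) => [[o _]|[s' _]|[_ b]].
  + by case: s => -[]; case: o => -> ->.
  + by case: s => -[]; case: s' => -> ->.
  (* The suffix found by [two_descents] ends in j here, while [conclude] starts from the side ending
     in i. *)
  + have b4 : wordmx D [:: j; i; j; i] = wordmx D [:: i; j; i; j].
      by have := reflmx_braid4 s; rewrite !wordmx_cons wordmx_nil !mulr1 -!mulrA.
    apply: (conclude R [:: j; i; j] [:: i; j; i]) => //=.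
    * by move: b; rewrite !big_cons !big_nil !mulr1 -!mulrA.
    * exact: reduced_subst (esym b4) rR.
Qed.

(** A letter at which the Demazure product does not ascend is the last letter of some reduced word
    of that product, so idempotency absorbs it. *)
Lemma demazure_prod (M : pzRingType) (f : I -> M) :
  (forall i j, i != j -> word_braided f i j) -> (forall i, f i * f i = f i) ->
  forall P Q, reduced_word (demazure D P) Q ->
  \prod_(q <- P) f q = \prod_(q <- Q) f q.
Proof.
move=> braid idem; elim/last_ind => [|P i IH] Q.
  by move=> [_]; rewrite /demazure /= wlen1 => /size0nil ->.
have dE : demazure D (rcons P i) =
    if ascends (demazure D P) i then demazure D P *> i else demazure D P.
  by rewrite /demazure foldl_rcons.
rewrite dE -cats1 big_cat big_seq1 /=; case: ifPn => [a|d] rQ.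
  have [R rR] := reduced_ex (demazure D P).
  have rRi : reduced_word (demazure D P *> i) (rcons R i).
    by apply: rcons_reduced; rewrite ?ascends_refl ?negbK ?weylK.
  by rewrite (IH _ rR) -(matsumoto braid rRi rQ) -cats1 big_cat big_seq1.
have [R rR] := reduced_ex (demazure D P *> i).
have rRi := rcons_reduced d rR.
by rewrite (IH _ rRi) -(matsumoto braid rRi rQ) -cats1 big_cat big_seq1 /= -mulrA idem.
Qed.

End ReducedWords.

(** * Reflections and divided differences *)

Section Families.
Context (n : nat) (I : finType) (D : root_datum n I).
Local Notation root := (sroot D).
Implicit Types (i j : I) (l m : 'cV[int]_n).

(* The relation of type B_2 is only available, and only needed, for b = 0. *)
Record braided (b : nat) (A : pzRingType) (f : I -> A) : Prop := Braided {
  braid2 : forall i j, orthogonal_roots D i j -> f i * f j = f j * f i;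
  braid3 : forall i j, span_A2 D i j -> f i * f j * f i = f j * f i * f j;
  braid4 : b = 0%N -> forall i j, span_B2 D i j ->
    f i * f j * f i * f j = f j * f i * f j * f i
}.

(** The value b = 0 gives the nil Hecke relations and b = 1 the zero Hecke relations. *)
Definition hecke_family b (A : pzRingType) (d : I -> A) : Prop :=
  (forall i, d i * d i = d i *+ b) /\ braided b d.

(* The additive (b = 0) or multiplicative (b = 1) formal group law. *)
Definition group_law b (P : comPzRingType) (X : 'cV[int]_n -> P) : Prop :=
  X 0 = 0 /\ forall l m, X (l + m) = X l + X m - (X l * X m) *+ b.

Section Weights.
Context (b : nat) (P : comPzRingType) (X : 'cV[int]_n -> P) (XL : group_law b X).
Context (A : pzRingType) (s : {rmorphism P -> A}).

Definition reflects (R : I -> A) : Prop :=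
  forall i l, R i * s (X l) = s (X (reflmx D i *m l)) * R i.

(** Given the first clause, the second is the quadratic relation [d i * d i = d i *+ b] multiplied
    by the weight of root i. *)
Definition divided_differences (R d : I -> A) : Prop :=
  (forall i, s (X (root i)) * d i = 1 - R i) /\
  (forall i, R i * d i = s (1 - X (root i) *+ b) * d i).

Lemma X_opp i : X (root i) + X (- root i) = (X (root i) * X (- root i)) *+ b.
Proof. by have := XL.2 (root i) (- root i); rewrite addrN XL.1 => /esym/subr0_eq. Qed.

Lemma reflmx_add i j : cartan D i j = -1 -> reflmx D i *m root j = root i + root j.
Proof. by move=> c; rewrite reflmx_root c scaleN1r opprK addrC. Qed.

Lemma reflmx_sub i j : cartan D i j = -1 -> reflmx D i *m (root i + root j) = root j.
Proof.
by move=> c; rewrite mulmxDr (reflmx_add c) reflmx_self addKr.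
Qed.

Lemma reflmx_add2 i j : cartan D i j = -2 ->
  reflmx D i *m root j = root j + root i + root i.
Proof.
by move=> c; rewrite reflmx_root c scaleNr opprK scaler_nat mulr2n addrA.
Qed.

Lemma sXC l m : s (X l) * s (X m) = s (X m) * s (X l).
Proof. by rewrite -!rmorphM mulrC. Qed.

Section Sums.
Context (R d : I -> A) (refl : reflects R) (dd : divided_differences R d).

Lemma divdiff_sum2 i j : orthogonal_roots D i j ->
  s (X (root i)) * s (X (root j)) * (d i * d j) = (1 - R i) * (1 - R j).
Proof.
move=> [c _]; apply: divdiff_comm; rewrite ?dd.1 //; first exact: sXC.
by rewrite refl reflmx_root c scale0r subr0.
Qed.

Lemma divdiff_sum3 i j : span_A2 D i j ->
  s (X (root i)) * s (X (root j)) * s (X (root i + root j)) * (d i * d j * d i)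
  = 1 - R i - R j + R i * R j + R j * R i - R i * R j * R i.
Proof.
move=> [cij cji].
apply: (divdiff_braid3 (dd.1 i) (dd.1 j) (sXC _ _) (sXC _ _) (sXC _ _) _ _ _ _ (dd.2 i)).
- by rewrite -rmorphM -rmorphD XL.2; congr (s _); ring.
- by rewrite refl reflmx_add.
- by rewrite refl reflmx_sub.
- by rewrite refl reflmx_add // addrC.
Qed.

Lemma divdiff_sum4 i j : b = 0%N -> cartan D i j = -1 -> cartan D j i = -2 ->
  let z := s (X (root i)) * s (X (root j)) * s (X (root i + root j))
     * s (X (root i + root j + root j)) in
  z * (d i * d j * d i * d j) = (1 - R i) * (1 + R j * R i) * (1 - R j) /\
  z * (d j * d i * d j * d i) = (1 - R j) * (1 + R i * R j) * (1 - R i).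
Proof.
move=> b0 cij cji z; have XD l m : X (l + m) = X l + X m.
  by rewrite XL.2 b0 subr0.
have dd2 k : R k * d k = d k by rewrite dd.2 b0 subr0 rmorph1 mul1r.
apply: (divdiff_braid4 (dd.1 i) (dd.1 j) (sXC _ _)) => //; try by rewrite !XD !rmorphD.
- by rewrite refl reflmx_add.
- by rewrite refl reflmx_sub.
- by rewrite refl mulmxDr reflmx_sub // reflmx_add // addrA [root j + _]addrC.
- by rewrite refl reflmx_add2.
- rewrite refl !mulmxDr reflmx_add2 // !reflmx_self.
  by rewrite !addrK.
- by rewrite refl mulmxDr reflmx_add2 // reflmx_self addrK.
Qed.

End Sums.

(** The braid relation for [d] equates two alternating sums of products of the [R]; their shorter
    terms are the same, so the longest products agree. *)
Lemma coxeter_of_hecke (d : I -> A) (R := fun i => 1 - s (X (root i)) * d i) :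
  hecke_family b d -> reflects R -> (forall i, R i * R i = 1) /\ braided b R.
Proof.
move=> [dsq dbr] refl.
have dd : divided_differences R d.
  split=> i; first by rewrite /R opprB addrC subrK.
  rewrite /R mulrBl mul1r -mulrA dsq mulrnAr rmorphB rmorph1 mulrBl mul1r.
  by rewrite rmorphMn mulrnAl.
(* Moving the weight past [R i] changes root i into its opposite; by [X_opp], X (-a) (1 - b X a) = -
   X a. *)
have Rsq i : R i * R i = 1.
  rewrite {2}/R mulrBr mulr1 mulrA refl reflmx_self -mulrA dd.2 mulrA -rmorphM.
  rewrite mulrBr mulr1 mulrnAr [X _ * X _]mulrC -X_opp opprD addrA addrAC subrr add0r.
  by rewrite rmorphN mulNr opprK subrK.
split=> //; split.
- move=> i j o; have e1 := divdiff_sum2 refl dd o.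
  have := divdiff_sum2 refl dd (orthogonal_roots_sym o).
  rewrite sXC -(braid2 dbr o) e1 => e.
  have -> : R i * R j = (1 - R i) * (1 - R j) - 1 + R i + R j by ncring.
  by rewrite e; ncring.
- move=> i j o; have e1 := divdiff_sum3 refl dd o.
  have := divdiff_sum3 refl dd (span_A2_sym o).
  rewrite (sXC (root j)) (addrC (root j)) -(braid3 dbr o) e1 => e.
  have -> : R i * R j * R i = 1 - R i - R j + R i * R j + R j * R i
    - (1 - R i - R j + R i * R j + R j * R i - R i * R j * R i) by ncring.
  by rewrite e; ncring.
move=> b0; have key i j : cartan D i j = -1 -> cartan D j i = -2 ->
    R i * R j * R i * R j = R j * R i * R j * R i.
  move=> cij cji; have [e1] := divdiff_sum4 refl dd b0 cij cji.
  rewrite (braid4 dbr b0 (or_intror (conj cji cij))) e1 => e.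
  have -> : R i * R j * R i * R j = (1 - R i) * (1 + R j * R i) * (1 - R j)
    - (1 - R i - R j + R i * R j + R j * R i - R i * R j * R i - R j * R i * R j) by ncring.
  by rewrite e; ncring.
by move=> i j [[cij cji]|[cij cji]]; [exact: key | rewrite (key j i)].
Qed.

(** Conversely, the alternating sums agree by the braid relations for [R], and the product of the
    weights of the positive roots can be cancelled. *)
Lemma hecke_of_coxeter (R d : I -> A) : reflects R -> (forall i, R i * R i = 1) ->
  braided b R -> (forall i, s (X (root i)) * d i = 1 - R i) ->
  (forall i, GRing.lreg (s (X (root i)))) -> hecke_family b d.
Proof.
move=> refl Rsq Rbr xd reg.
(* Regularity is given at simple roots only. The other positive roots of a rank two system are
   reached by reflections, and conjugation by the invertible [R i] preserves regularity. *)
have reg_refl i l : GRing.lreg (s (X l)) -> GRing.lreg (s (X (reflmx D i *m l))).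
  move=> rl u v /(congr1 (fun z => R i * z)).
  rewrite !mulrA !refl mulmxA mulmxE reflmxK mul1mx -!mulrA => /rl.
  by move/(congr1 (fun z => R i * z)); rewrite !mulrA Rsq !mul1r.
have dd : divided_differences R d.
  split=> // i; apply: (reg_refl i _ (reg i)).
  rewrite mulrA -refl -mulrA xd mulrBr mulr1 Rsq reflmx_self mulrA -rmorphM.
  rewrite mulrBr mulr1 mulrnAr [X _ * X _]mulrC -X_opp opprD addrA addrAC subrr add0r.
  by rewrite rmorphN mulNr xd opprB.
split.
  move=> i; apply: (reg i); rewrite mulrA xd mulrBl mul1r dd.2 rmorphB rmorph1 mulrBl mul1r.
  by rewrite subKr rmorphMn mulrnAl mulrnAr.
split.
- move=> i j o; apply: (GRing.lregM (reg i) (reg j)).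
  rewrite (divdiff_sum2 refl dd o) sXC (divdiff_sum2 refl dd (orthogonal_roots_sym o)).
  have -> : (1 - R i) * (1 - R j) = 1 - R i - R j + R i * R j by ncring.
  by rewrite (braid2 Rbr o); ncring.
- move=> i j o.
  have rij : GRing.lreg (s (X (root i + root j))).
    by rewrite -(reflmx_add o.1); exact: reg_refl.
  apply: (GRing.lregM (GRing.lregM (reg i) (reg j)) rij).
  rewrite (divdiff_sum3 refl dd o) (sXC (root i)) (addrC (root i)).
  rewrite (divdiff_sum3 refl dd (span_A2_sym o)) (braid3 Rbr o); ncring.
move=> b0; have key i j : cartan D i j = -1 -> cartan D j i = -2 ->
    d i * d j * d i * d j = d j * d i * d j * d i.
  move=> cij cji; have [e1 e2] := divdiff_sum4 refl dd b0 cij cji.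
  have rij : GRing.lreg (s (X (root i + root j))).
    by rewrite -(reflmx_add cij); exact: reg_refl.
  have rijj : GRing.lreg (s (X (root i + root j + root j))).
    by rewrite -(reflmx_add2 cji); exact: reg_refl.
  apply: (GRing.lregM (GRing.lregM (GRing.lregM (reg i) (reg j)) rij) rijj).
  rewrite e1 e2.
  have -> : (1 - R i) * (1 + R j * R i) * (1 - R j)
     = 1 - R i - R j + R i * R j + R j * R i - R i * R j * R i - R j * R i * R j
       + R i * R j * R i * R j by ncring.
  by rewrite (braid4 Rbr b0 (or_introl (conj cij cji))); ncring.
by move=> i j [[cij cji]|[cij cji]]; [exact: key | rewrite (key j i)].
Qed.

(** * Twisting reflections by a commuting Hecke family *)

Section Twist.
Context (R d : I -> A) (refl : reflects R) (Rsq : forall i, R i * R i = 1).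
Context (Rbr : braided b R) (dH : hecke_family b d).
Hypotheses (ds : forall i p, d i * s p = s p * d i)
  (dR : forall i j, d i * R j = R j * d i).

Definition twist i := (1 - s (X (root i)) * d i) * R i.

Let h i l := 1 - s (X l) * d i.

Let Rh i j l : R i * h j l = h j (reflmx D i *m l) * R i.
Proof.
rewrite /h mulrBr mulrBl mulr1 mul1r mulrA refl -!mulrA; congr (_ - _ * _).
by rewrite dR.
Qed.

(** The group law makes [h i] exponential: the quadratic relation for [d i] supplies exactly its
    cross term. *)
Let hh i l m : h i l * h i m = h i (l + m).
Proof.
rewrite /h XL.2; have [dsq _] := dH.
reassoc (1 - s (X l) * d i - s (X m) * d i + s (X l) * (d i * s (X m)) * d i).
rewrite ds; reassoc (1 - s (X l) * d i - s (X m) * d i + s (X l) * s (X m) * (d i * d i)).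
rewrite dsq mulrnAr rmorphB rmorphD rmorphMn rmorphM mulrBl mulrDl mulrnAl opprB opprD.
ncring.
Qed.

Lemma twist_reflects : reflects twist.
Proof.
move=> i l; rewrite /twist -mulrA refl !mulrA; congr (_ * _).
rewrite mulrBl mulrBr mul1r mulr1 -mulrA ds !mulrA; congr (_ - _ * _).
exact: sXC.
Qed.

Lemma twist_sq i : twist i * twist i = 1.
Proof.
rewrite /twist -/(h i _) mulrA -(mulrA (h i _)) Rh -!mulrA Rsq mulr1 hh reflmx_self addrN.
by rewrite /h XL.1 rmorph0 mul0r subr0.
Qed.

(** Collecting the [R] on the right leaves factors [h] at the positive roots, in two opposite orders
    for the two sides; the Yang-Baxter equation identifies them. *)
Lemma twist_braided : braided b twist.
Proof.
have [dsq dbr] := dH.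
have T2 i j : twist i * twist j
    = h i (root i) * h j (reflmx D i *m root j) * (R i * R j).
  by rewrite /twist -/(h i _) -/(h j _) mulrA -(mulrA (h i _)) Rh !mulrA.
have RRh i j k l : R i * R j * h k l
    = h k (reflmx D i *m (reflmx D j *m l)) * (R i * R j).
  by rewrite -mulrA Rh mulrA Rh -mulrA.
have T3 i j : twist i * twist j * twist i
    = h i (root i) * h j (reflmx D i *m root j)
      * h i (reflmx D i *m (reflmx D j *m root i)) * (R i * R j * R i).
  rewrite T2 /twist -/(h i _).
  reassoc (h i (root i) * h j (reflmx D i *m root j) * (R i * R j * h i (root i)) * R i).
  by rewrite RRh; ncring.
have T4 i j : twist i * twist j * twist i * twist j
    = h i (root i) * h j (reflmx D i *m root j)
      * h i (reflmx D i *m (reflmx D j *m root i))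
      * h j (reflmx D i *m (reflmx D j *m (reflmx D i *m root j)))
      * (R i * R j * R i * R j).
  rewrite T3 /twist -/(h j _); move: (h i (root i) * _ * _) => z.
  reassoc (z * (R i * (R j * R i * h j (root j))) * R j); rewrite RRh.
  reassoc (z * (R i * h j (reflmx D j *m (reflmx D i *m root j))) * R j * R i * R j).
  by rewrite Rh; ncring.
split.
- move=> i j o; rewrite !T2 (braid2 Rbr o); congr (_ * _).
  rewrite !reflmx_root o.1 o.2 !scale0r !subr0 /h.
  set x := s _; set y := s _; have xy : x * y = y * x by exact: sXC.
  reassoc (1 - x * d i - y * d j + x * (d i * y) * d j); rewrite ds.
  reassoc (1 - x * d i - y * d j + x * y * (d i * d j)).
  rewrite xy (braid2 dbr o).
  transitivity (1 - x * d i - y * d j + y * (d j * x) * d i); last by ncring.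
  by rewrite ds; ncring.
- move=> i j o; rewrite !T3 (braid3 Rbr o); congr (_ * _).
  rewrite (reflmx_add o.1) (reflmx_add o.2) (addrC (root j)) (reflmx_sub o.1).
  rewrite [X in reflmx D j *m X]addrC (reflmx_sub o.2).
  apply: yang_baxter3; rewrite ?ds //; try exact: sXC; first exact: (braid3 dbr o).
    exact: hh.
  by rewrite [root i + _]addrC; exact: hh.
move=> b0; have key i j : cartan D i j = -1 -> cartan D j i = -2 ->
    twist i * twist j * twist i * twist j = twist j * twist i * twist j * twist i.
  move=> cij cji; rewrite !T4 (braid4 Rbr b0 (or_introl (conj cij cji))); congr (_ * _).
  have XD l m : X (l + m) = X l + X m by rewrite XL.2 b0 subr0.
  have ej : reflmx D j *m (root i + root j) = root i + root j.
    by rewrite mulmxDr (reflmx_add2 cji) reflmx_self addrK.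
  have ei : reflmx D i *m (root i + root j + root j) = root i + root j + root j.
    by rewrite mulmxDr (reflmx_sub cij) (reflmx_add cij) addrC.
  have ej2 : reflmx D j *m (root i + root j + root j) = root i.
    by rewrite mulmxDr ej reflmx_self addrK.
  rewrite (reflmx_add2 cji) ei (reflmx_add cij) ej (reflmx_sub cij) ej2.
  rewrite /h !XD !rmorphD.
  apply: yang_baxter4; rewrite ?ds //; first exact: sXC.
  - exact: (braid4 dbr b0 (or_introl (conj cij cji))).
  - by rewrite dsq b0.
  - by rewrite dsq b0.
by move=> i j [[cij cji]|[cij cji]]; [exact: key | rewrite (key j i)].
Qed.

End Twist.

End Weights.
End Families.

(** * Tensor products with free rings *)

Section FreeCombinations.
Context (K : choiceType) (G V : zmodType).

(** The map on finitely supported families induced by [F]. When [F] is additive in its second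
    argument the support may be replaced by any larger finite set. *)
Definition malg_lift (F : K -> G -> V) (g : monalg.malg K G) : V :=
  \sum_(k <- monalg.msupp g) F k (monalg.mcoeff k g).

Context (F : K -> G -> V) (FD : forall k u v, F k (u + v) = F k u + F k v).

Let F0 k : F k 0 = 0.
Proof. by apply: (addrI (F k 0)); rewrite -FD !addr0. Qed.

Lemma malg_liftw (S : {fset K}) (g : monalg.malg K G) : (monalg.msupp g `<=` S)%fset ->
  malg_lift F g = \sum_(k <- S) F k (monalg.mcoeff k g).
Proof. by move=> le; apply/big_fset_incl => // k _ /monalg.mcoeff_outdom ->. Qed.

Lemma malg_liftD g h : malg_lift F (g + h) = malg_lift F g + malg_lift F h.
Proof.
rewrite (malg_liftw (monalg.msuppD_le g h)) (malg_liftw (fsubsetUl _ (monalg.msupp h))).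
rewrite (malg_liftw (fsubsetUr (monalg.msupp g) _)) -big_split /=.
by apply: eq_bigr => k _; rewrite monalg.mcoeffD FD.
Qed.

Lemma malg_lift_sum (J : Type) (r : seq J) (E : J -> monalg.malg K G) :
  malg_lift F (\sum_(j <- r) E j) = \sum_(j <- r) malg_lift F (E j).
Proof. by apply: (big_morph _ malg_liftD); rewrite /malg_lift monalg.msupp0 big_seq_fset0. Qed.

Lemma malg_liftU k u : malg_lift F (monalg.mkmalgU k u) = F k u.
Proof. by rewrite (malg_liftw monalg.msuppU_le) big_seq_fset1 monalg.mcoeffUU. Qed.

End FreeCombinations.

Section LeftBasis.
Context (R A : nzRingType) (s : {rmorphism R -> A}) (J : choiceType) (b : J -> A).
Hypothesis bP : left_basis s b.

(** Multiplication by [s p] multiplies the coordinates by [p]. If the product is 0, uniqueness makes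
    these coordinates 0, and [p] can be cancelled in each. *)
Lemma left_basis_lreg (p : R) : GRing.lreg p -> GRing.lreg (s p).
Proof.
move=> preg; apply: mulrI0_lreg => a pa0; have [c [ac _]] := bP a.
have [d [_ dU]] := bP 0.
pose pc : {fsfun J -> R with 0} := [fsfun j in finsupp c => p * c j].
pose z : {fsfun J -> R with 0} := [fsfun].
have pcE j : pc j = p * c j.
  by rewrite fsfunE; case: finsuppP => // _; rewrite mulr0.
have /dU dz : 0 = \sum_(j <- finsupp z) s (z j) * b j.
  by rewrite finsupp0 big_seq_fset0.
have /dU dpc : 0 = \sum_(j <- finsupp pc) s (pc j) * b j.
  transitivity (s p * a); first by rewrite pa0.
  rewrite ac mulr_sumr; symmetry.
  have le : (finsupp pc `<=` finsupp c)%fset.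
    by apply/fsubsetP => j; rewrite !mem_finsupp pcE; apply: contra => /eqP->; rewrite mulr0.
  rewrite (big_fset_incl _ le); last first.
    by move=> j _; rewrite memNfinsupp => /eqP ->; rewrite rmorph0 mul0r.
  by apply: eq_bigr => j _; rewrite pcE rmorphM mulrA.
rewrite ac big1 // => j _; have : p * c j = p * 0.
  by rewrite -pcE -dpc dz fsfun0E mulr0.
by move/preg ->; rewrite rmorph0 mul0r.
Qed.

(** Coordinates are chosen for every element; their uniqueness makes the choice additive. *)
Lemma left_basis_coord : exists c : A -> monalg.malg J R,
  (forall a, a = malg_lift (fun j u => s u * b j) (c a)) /\
  (forall a a', c (a + a') = c a + c a').
Proof.
pose M (g : monalg.malg J R) := malg_lift (fun j u => s u * b j) g.
have MD : forall g h, M (g + h) = M g + M h.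
  by apply: malg_liftD => j u v; rewrite rmorphD mulrDl.
have ex a : exists g, a = M g.
  by have [c [ac _]] := bP a; exists (monalg.mkmalg c); rewrite ac /M /malg_lift.
have inj g h : M g = M h -> g = h.
  move=> gh; have [c [_ cU]] := bP (M g).
  have := cU _ gh; rewrite (cU (monalg.malg_val g) erefl).
  by case: g h {gh cU} => g [h] /= ->.
pose c a := sval (boolp.cid (ex a)).
have cE a : a = M (c a) by exact: svalP (boolp.cid (ex a)).
exists c; split=> // a a'; apply: inj.
by rewrite MD -!cE.
Qed.

End LeftBasis.

Section Tensor.
Context (A B C : nzRingType) (T : tensor3 A B C).

Lemma pureDl a a' x y : pure T (a + a') x y = pure T a x y + pure T a' x y.
Proof. by have [h _ _] := pure_add T. Qed.
Lemma pureDm a x x' y : pure T a (x + x') y = pure T a x y + pure T a x' y.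
Proof. by have [_ h _] := pure_add T. Qed.
Lemma pureDr a x y y' : pure T a x (y + y') = pure T a x y + pure T a x y'.
Proof. by have [_ _ h] := pure_add T. Qed.

Definition pure_l (a : A) : T := pure T a 1 1.
Definition pure_m (x : B) : T := pure T 1 x 1.
Definition pure_r (y : C) : T := pure T 1 1 y.

Fact additive_zmod (U V : zmodType) (f : U -> V) :
  (forall u v, f (u + v) = f u + f v) -> zmod_morphism f.
Proof.
by move=> fD u v; apply: (addIr (f v)); rewrite -fD !subrK.
Qed.

Fact pure_l_additive : zmod_morphism pure_l.
Proof. by apply: additive_zmod => a a'; exact: pureDl. Qed.
Fact pure_m_additive : zmod_morphism pure_m.
Proof. by apply: additive_zmod => a a'; exact: pureDm. Qed.
Fact pure_r_additive : zmod_morphism pure_r.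
Proof. by apply: additive_zmod => a a'; exact: pureDr. Qed.

Fact pure_l_monoid : monoid_morphism pure_l.
Proof. by split=> [|a a']; rewrite /pure_l ?pureM ?mulr1 ?pure1. Qed.
Fact pure_m_monoid : monoid_morphism pure_m.
Proof. by split=> [|a a']; rewrite /pure_m ?pureM ?mulr1 ?pure1. Qed.
Fact pure_r_monoid : monoid_morphism pure_r.
Proof. by split=> [|a a']; rewrite /pure_r ?pureM ?mulr1 ?pure1. Qed.

HB.instance Definition _ := GRing.isZmodMorphism.Build A T pure_l pure_l_additive.
HB.instance Definition _ := GRing.isMonoidMorphism.Build A T pure_l pure_l_monoid.
HB.instance Definition _ := GRing.isZmodMorphism.Build B T pure_m pure_m_additive.
HB.instance Definition _ := GRing.isMonoidMorphism.Build B T pure_m pure_m_monoid.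
HB.instance Definition _ := GRing.isZmodMorphism.Build C T pure_r pure_r_additive.
HB.instance Definition _ := GRing.isMonoidMorphism.Build C T pure_r pure_r_monoid.

Lemma pureE a x y : pure T a x y = pure_l a * pure_m x * pure_r y.
Proof. by rewrite !pureM !mulr1 !mul1r. Qed.

Lemma pure_lmC a x : pure_l a * pure_m x = pure_m x * pure_l a.
Proof. by rewrite !pureM !mulr1 !mul1r. Qed.
Lemma pure_lrC a y : pure_l a * pure_r y = pure_r y * pure_l a.
Proof. by rewrite !pureM !mulr1 !mul1r. Qed.
Lemma pure_mrC x y : pure_m x * pure_r y = pure_r y * pure_m x.
Proof. by rewrite !pureM !mulr1 !mul1r. Qed.

Lemma tensor_ext (V : zmodType) (f g : T -> V) :
  (forall u v, f (u + v) = f u + f v) -> (forall u v, g (u + v) = g u + g v) ->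
  (forall a x y, f (pure T a x y) = g (pure T a x y)) -> f =1 g.
Proof.
move=> /additive_zmod fA /additive_zmod gA.
pose F : {additive T -> V} := HB.pack f (GRing.isZmodMorphism.Build T V f fA).
pose G : {additive T -> V} := HB.pack g (GRing.isZmodMorphism.Build T V g gA).
exact: (@t3_uniq _ _ _ T V F G).
Qed.

End Tensor.

(* With B and C free over Z, a tensor is determined by its coefficients in A. *)
Lemma pure_l_lreg (A B C : nzRingType) (T : tensor3 A B C) (J K : choiceType)
    (b : J -> B) (c : K -> C) (p : A) :
  left_basis (intr : int -> B) b -> left_basis (intr : int -> C) c ->
  GRing.lreg p -> GRing.lreg (pure_l T p).
Proof.
move=> bP cP preg.
have [f [fE fD]] := left_basis_coord bP; have [g [gE gD]] := left_basis_coord cP.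
pose E a (jk : J * K) : T := pure_l T a * pure_m T (b jk.1) * pure_r T (c jk.2).
(* The pure tensor of [a], [x], [y] is to have at [(j, k)] the coordinate [a] times the integers
   [f x] at [j] and [g y] at [k]. *)
pose in2 (a : A) (j : J) (u : int) (k : K) (v : int) := monalg.mkmalgU (j, k) (a *~ (u * v)).
pose in1 a y j u := malg_lift (in2 a j u) (g y).
pose to a x y := malg_lift (in1 a y) (f x).
have in2D a j u k v v' : in2 a j u k (v + v') = in2 a j u k v + in2 a j u k v'.
  by rewrite /in2 mulrDr mulrzDr monalg.monalgUD.
have in2Du a j u u' k v : in2 a j (u + u') k v = in2 a j u k v + in2 a j u' k v.
  by rewrite /in2 mulrDl mulrzDr monalg.monalgUD.
have in2Da a a' j u k v : in2 (a + a') j u k v = in2 a j u k v + in2 a' j u k v.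
  by rewrite /in2 mulrzDl monalg.monalgUD.
have in1D a y j u u' : in1 a y j (u + u') = in1 a y j u + in1 a y j u'.
  by rewrite /in1 -big_split; apply: eq_bigr => k _; exact: in2Du.
have toA : triadditive to.
  split=> [a a' x y|a x x' y|a x y y'].
  - rewrite /to -big_split; apply: eq_bigr => j _.
    by rewrite /in1 -big_split; apply: eq_bigr => k _; exact: in2Da.
  - by rewrite /to fD malg_liftD.
  - rewrite /to -big_split; apply: eq_bigr => j _.
    by rewrite /in1 gD malg_liftD.
have [phi phiE] := t3_lift T toA.
(* [psi] rebuilds a tensor from its coordinates, so [phi] is injective. *)
pose psi := malg_lift (fun jk a => E a jk).
have ED jk a a' : E (a + a') jk = E a jk + E a' jk.
  by rewrite /E rmorphD !mulrDl.
have phiK : cancel phi psi.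
  apply: tensor_ext => [u v|//|a x y]; first by rewrite raddfD /psi malg_liftD.
  rewrite phiE /to /psi malg_lift_sum // pureE [in RHS](fE x) rmorph_sum mulr_sumr mulr_suml.
  apply: eq_bigr => j _; rewrite /in1 malg_lift_sum // [in RHS](gE y) rmorph_sum mulr_sumr.
  apply: eq_bigr => k _; rewrite malg_liftU // /E /=.
  move: (monalg.mcoeff j _) (monalg.mcoeff k _) => u v.
  rewrite raddfMz (rmorphM (pure_m T)) (rmorphM (pure_r T)) !rmorph_int.
  by rewrite !mulrzl !mulrzAr !mulrzAl mulrzA.
(* Left multiplication by [pure_l T p] acts on each coordinate as multiplication by [p], which is
   regular. *)
have phiM z jk : monalg.mcoeff jk (phi (pure_l T p * z)) = p * monalg.mcoeff jk (phi z).
  move: z; apply: tensor_ext => [u v|u v|a x y].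
  - by rewrite mulrDr raddfD monalg.mcoeffD.
  - by rewrite raddfD monalg.mcoeffD mulrDr.
  rewrite pureM !mul1r !phiE /to !(raddf_sum (monalg.mcoeff jk)) mulr_sumr.
  apply: eq_bigr => j _; rewrite /in1 !(raddf_sum (monalg.mcoeff jk)) mulr_sumr.
  apply: eq_bigr => k _.
  by rewrite /in2 /= !monalg.mcoeffU -mulrzAr mulrnAr.
move=> u v uv; apply: (can_inj phiK); apply/monalg.malgP => jk; apply: preg.
by rewrite -!phiM uv.
Qed.

(** * The elements L and Lambda *)

Section HeckeGenerators.
Context (n : nat) (I : finType) (D : root_datum n I).
Local Notation "w *> i" := (weylM w (srefl D i)) (at level 40, left associativity).
Local Notation root := (sroot D).
Implicit Types i j : I.

Lemma braided_rmorph b (A B : pzRingType) (phi : {rmorphism A -> B}) (f : I -> A) :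
  braided D b f -> braided D b (fun i => phi (f i)).
Proof.
case=> f2 f3 f4; split=> [i j o|i j o|b0 i j o]; rewrite -!rmorphM.
- by rewrite f2.
- by rewrite f3.
by rewrite f4.
Qed.

Lemma hecke_rmorph b (A B : pzRingType) (phi : {rmorphism A -> B}) (f : I -> A) :
  hecke_family D b f -> hecke_family D b (fun i => phi (f i)).
Proof.
by case=> fsq /(braided_rmorph phi); split=> // i; rewrite -rmorphM fsq rmorphMn.
Qed.

Lemma nil_hecke_opp (A : pzRingType) (f : I -> A) :
  hecke_family D 0 f -> hecke_family D 0 (fun i => - f i).
Proof.
case=> fsq [f2 f3 f4]; split=> [i|]; first by rewrite mulrNN fsq.
split=> [i j o|i j o|b0 i j o]; rewrite ?mulrNN ?mulrN ?mulNr ?opprK.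
- by rewrite f2.
- by rewrite f3.
by rewrite f4.
Qed.

Lemma weyl1M i : weyl1 D *> i = srefl D i.
Proof.
by apply: weyl_inj; rewrite wmx_refl [wmx (weyl1 D)]big_nil mul1r /= wordmx1.
Qed.

Lemma srefl_word i : srefl D i = word_elt D [:: i].
Proof. by []. Qed.

Lemma wlen_srefl i : wlen (srefl D i) = 1%N.
Proof.
have := odd_wlen_refl (weyl1 D) i; rewrite wlen1 weyl1M.
by have := wlen_word D [:: i]; rewrite -srefl_word /=; case: (wlen _) => [|[]].
Qed.

Lemma srefl_inj : injective (srefl D).
Proof.
move=> i j /(congr1 (@wmx _ _ _)); rewrite !srefl_word !wmx_word !wordmx1.
exact: reflmx_inj.
Qed.

Lemma nascends_srefl i : ascends (srefl D i) i = false.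
Proof.
apply/negbTE; rewrite -ascends_refl /ascends weylK wlen_srefl.
have -> : srefl D i *> i = weyl1 D; last by rewrite wlen1.
apply: weyl_inj; rewrite wmx_refl srefl_word wmx_word wordmx1 reflmxK.
by rewrite [RHS]big_nil.
Qed.

Lemma ascends_srefl i j : i != j -> ascends (srefl D i) j.
Proof.
move=> ne_ij; apply: contraT => /descendsP; rewrite wlen_srefl => -[] /esym/wlen_eq0 e.
by case/eqP: ne_ij; apply: srefl_inj; rewrite -[LHS](weylK _ j) e weyl1M.
Qed.

(** Otherwise s_i s_j s_i has length one and is some s_k. Evaluated at root i this makes root i +
    root j a multiple of root k, against linear independence. *)
Lemma ascends_srefl2 i j : span_A2 D i j -> ascends (srefl D i *> j) i.
Proof.
move=> s; have ne_ij : i != j by apply/eqP => ij; case: s; rewrite ij cartan_diag.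
apply: contraT => /descendsP; rewrite (ascendsP (ascends_srefl ne_ij)) wlen_srefl.
move=> -[] e; have [Q [Qw szQ]] := reduced_ex (srefl D i *> j *> i).
rewrite -e in szQ; case: Q szQ Qw => [//|k [|//]] _.
move/(congr1 (@wmx _ _ _)); rewrite !wmx_refl !srefl_word !wmx_word !wordmx1.
move/(congr1 (fun M => M *m root i)); rewrite -!mulmxE -!mulmxA reflmx_self !mulmxN.
rewrite (reflmx_add s.2) (addrC (root j)) (reflmx_sub s.1) reflmx_root.
move/(congr1 (fun x => root i - x)); rewrite subKr opprK root_sum.
rewrite -[root i]scale1r -[root j]scale1r !root_sum -big_split /=.
under [RHS]eq_bigr do rewrite -scalerDl.
move/root_coefP => c; have := c i; have := c j.
rewrite !eqxx (eq_sym j i) (negbTE ne_ij); case: (eqVneq i k) => [<-|_]; last first.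
  by rewrite mulr0n addr0 => _ /eqP.
by rewrite eq_sym (negbTE ne_ij) mulr0n add0r => /eqP.
Qed.

Lemma span_A2_neq i j : span_A2 D i j -> i != j.
Proof. by move=> s; apply/eqP => ij; case: s; rewrite ij cartan_diag. Qed.

Lemma orthogonal_roots_neq i j : orthogonal_roots D i j -> i != j.
Proof. by move=> s; apply/eqP => ij; case: s; rewrite ij cartan_diag. Qed.

(* The axioms do not say that nh_elt 1 = 1, hence the restriction to nonempty
   words. *)
Lemma nh_word (N : nil_hecke D) i Q : \prod_(q <- i :: Q) nh_gen N q
  = if wlen (word_elt D (i :: Q)) == (size Q).+1 then nh_elt N (word_elt D (i :: Q)) else 0.
Proof.
elim/last_ind: Q => [|Q j IH].
  by rewrite big_seq1 -srefl_word wlen_srefl eqxx.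
rewrite -rcons_cons word_elt_rcons size_rcons -cats1 big_cat big_seq1 /= IH.
have le1 := wlen_word D (i :: Q); have le2 := wlen_refl_le (word_elt D (i :: Q)) j.
case: (eqVneq (wlen (word_elt D (i :: Q)))) => [e|ne].
  by rewrite /nh_gen nh_mul /ascends e.
rewrite mul0r; case: eqVneq => // e.
by case/eqP: ne; apply/eqP; rewrite eqn_leq le1 /=; rewrite e in le2.
Qed.

(** By [nh_word] a product of generators depends only on the length of the word and on its Weyl
    element, which are the same for the two sides of a braid relation. *)
Lemma nh_hecke (N : nil_hecke D) : hecke_family D 0 (nh_gen N).
Proof.
have word_eq i P j Q : wordmx D (i :: P) = wordmx D (j :: Q) -> size P = size Q ->
    \prod_(q <- i :: P) nh_gen N q = \prod_(q <- j :: Q) nh_gen N q.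
  by move=> /word_eltP e sz; rewrite !nh_word e sz.
split=> [i|]; first by rewrite /nh_gen nh_mul nascends_srefl.
split=> [i j o|i j o|_ i j o].
- have := word_eq i [:: j] j [:: i]; rewrite !big_cons !big_nil !mulr1; apply=> //.
  by rewrite !wordmx_cons wordmx_nil !mulr1 (reflmx_comm o).
- have := word_eq i [:: j; i] j [:: i; j]; rewrite !big_cons !big_nil !mulr1 !mulrA.
  by apply=> //; rewrite !wordmx_cons wordmx_nil !mulr1 !mulrA (reflmx_braid3 o).
have := word_eq i [:: j; i; j] j [:: i; j; i]; rewrite !big_cons !big_nil !mulr1 !mulrA.
by apply=> //; rewrite !wordmx_cons wordmx_nil !mulr1 !mulrA (reflmx_braid4 o).
Qed.

(** Nonascending letters are absorbed here rather than killed, so the ascents along both sides of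
    the relation are checked. *)
Lemma zh_hecke (Z : zero_hecke D) : hecke_family D 1 (zh_gen Z).
Proof.
split=> [i|]; first by rewrite /zh_gen zh_mul nascends_srefl.
have mul2 i j : i != j -> zh_gen Z i * zh_gen Z j = zh_elt Z (srefl D i *> j).
  by move=> ne_ij; rewrite /zh_gen zh_mul ascends_srefl.
split=> [i j o|i j o|//].
- have ne_ij := orthogonal_roots_neq o.
  rewrite !mul2 // 1?eq_sym //; congr (zh_elt _ _).
  by rewrite -[X in X *> j]weyl1M -[X in _ = X *> i]weyl1M (weyl_comm _ o).
have ne_ij := span_A2_neq o.
rewrite !mul2 // 1?eq_sym // /zh_gen !zh_mul (ascends_srefl2 o).
rewrite (ascends_srefl2 (span_A2_sym o)); congr (zh_elt _ _).
by rewrite -[X in X *> j *> i]weyl1M -[X in _ = X *> i *> j]weyl1M (weyl_braid3 _ o).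
Qed.

(** * Divided differences of the doubly twisted reflections *)

Section TensorHecke.
Context (b : nat) (P : comPzRingType) (X : 'cV[int]_n -> P) (XL : group_law b X).
Context (A B C : nzRingType) (s : {rmorphism P -> A}) (T : tensor3 A B C).
Context (J K : choiceType) (bB : J -> B) (bC : K -> C).
Hypotheses (bBP : left_basis (intr : int -> B) bB) (bCP : left_basis (intr : int -> C) bC).
Context (r u : I -> A) (d : I -> B) (d' : I -> C).
Hypotheses (refl : reflects D X s r) (rsq : forall i, r i * r i = 1).
Hypotheses (rbr : braided D b r) (dH : hecke_family D b d) (dH' : hecke_family D b d').
Hypothesis Xreg : forall i, GRing.lreg (s (X (root i))).
Hypothesis xu : forall i, s (X (root i)) * u i = 1 - r i.

(* The reflections r i are twisted by the second and third tensor factors in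
   turn; the stated elements are the divided differences of the result. *)
Lemma tensor_hecke : hecke_family D b (fun i =>
  pure T (u i) 1 1 + pure T (r i) (d i) 1 + pure T (r i) 1 (d' i)
  - pure T (s (X (root i)) * r i) (d i) (d' i)).
Proof.
pose sT : {rmorphism P -> T} := pure_l T \o s.
pose R i := pure_l T (r i).
have reflR : reflects D X sT R by move=> i l; rewrite /R /= -!rmorphM refl.
have Rsq i : R i * R i = 1 by rewrite /R -rmorphM rsq rmorph1.
have Rbr : braided D b R by exact: braided_rmorph.
pose dm i := pure_m T (d i); have dmH : hecke_family D b dm by exact: hecke_rmorph.
pose dr i := pure_r T (d' i); have drH : hecke_family D b dr by exact: hecke_rmorph.
have dms i p : dm i * sT p = sT p * dm i by rewrite /= pure_lmC.
have drs i p : dr i * sT p = sT p * dr i by rewrite /= pure_lrC.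
have dmR i j : dm i * R j = R j * dm i by rewrite /R pure_lmC.
have drR i j : dr i * R j = R j * dr i by rewrite /R pure_lrC.
have drm i j : dr i * dm j = dm j * dr i by rewrite /dr pure_mrC.
pose R1 := twist D X sT R dm.
have reflR1 : reflects D X sT R1 by exact: twist_reflects.
have R1sq : forall i, R1 i * R1 i = 1 by exact: (twist_sq XL).
have R1br : braided D b R1 by exact: (twist_braided XL).
have drR1 i j : dr i * R1 j = R1 j * dr i.
  rewrite /R1 /twist; set x := sT _.
  reassoc (dr i * R j - (dr i * x) * dm j * R j); rewrite drs.
  reassoc (dr i * R j - x * (dr i * dm j) * R j); rewrite drm.
  by reassoc ((1 - x * dm j) * (dr i * R j)); rewrite drR; ncring.
pose R2 := twist D X sT R1 dr.
have reflR2 : reflects D X sT R2 by exact: twist_reflects.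
have R2sq : forall i, R2 i * R2 i = 1 by exact: (twist_sq XL).
have R2br : braided D b R2 by exact: (twist_braided XL).
apply: (hecke_of_coxeter XL reflR2 R2sq R2br) => i; last first.
  exact: (pure_l_lreg bBP bCP).
(* It remains to see that [x] times the stated element is [1 - R2 i], where [R2 i] is (1 - x dr) (1
   - x dm) R; the term with [u i] contributes 1 - R. *)
rewrite !pureE !rmorph1 !mulr1 rmorphM /R2 /twist /R1 /twist /= -/(dm i) -/(dr i) -/(R i).
have := congr1 (pure_l T) (xu i); rewrite rmorphM rmorphB rmorph1 /= -/(R i).
have drx := drs i (X (root i)); rewrite /= in drx.
set x := pure_l T (s _) in drx *; move: (pure_l T (u i)) => v xv.
reassoc (x * v + x * R i * dm i + x * R i * dr i - x * x * R i * dm i * dr i).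
rewrite xv; symmetry.
reassoc (1 - (R i - x * (dm i * R i) - x * (dr i * R i) + x * (dr i * x) * (dm i * R i))).
rewrite drx dmR drR; reassoc (1 - (R i - x * (R i * dm i) - x * (R i * dr i)
  + x * x * (dr i * R i) * dm i)); rewrite drR.
reassoc (1 - (R i - x * (R i * dm i) - x * (R i * dr i)
  + x * x * R i * (dr i * dm i))); rewrite drm.
ncring.
Qed.

End TensorHecke.

Lemma hecke_word_braided b (A : pzRingType) (f : I -> A) : hecke_family D b f ->
  (b = 0%N /\ doubly_laced D) \/ simply_laced D ->
  forall i j, i != j -> word_braided D f i j.
Proof.
move=> [_ [f2 f3 f4]] lacedD i j ne_ij; case: lacedD => [[b0 /(_ _ _ ne_ij)]|/(_ _ _ ne_ij)].
  by case=> o; [constructor 1|constructor 2|constructor 3]; split=> //; auto.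
by case=> o; [constructor 1|constructor 2]; split=> //; auto.
Qed.

Lemma simply_doubly : simply_laced D -> doubly_laced D.
Proof. by move=> sl i j /sl[]; [constructor 1|constructor 2]. Qed.

End HeckeGenerators.

(** * Specialization to the additive law and to two multiplicative laws *)

Section Instances.
Context (n : nat) (I : finType) (D : root_datum n I).
Local Notation root := (sroot D).
Implicit Types (i j : I) (l : 'cV[int]_n).

Lemma wt_group_law : group_law 0 (@wt n).
Proof.
split=> [|l m]; last by rewrite wtD subr0.
by rewrite -[0 in LHS](scale0r (0 : 'cV[int]_n)) wtZ scale0r.
Qed.

Lemma reflH_wt i l : reflH D i (wt l) = wt (reflmx D i *m l).
Proof.
have -> : reflmx D i *m l = \sum_k l k 0 *: col k (reflmx D i).
  apply/matrixP => a c; rewrite ord1 mxE summxE; apply: eq_bigr => k _.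
  by rewrite !mxE mulrC.
have -> : wt (\sum_k l k 0 *: col k (reflmx D i)) = \sum_k l k 0 *: wt (col k (reflmx D i)).
  rewrite (big_morph _ (@wtD n) (wt_group_law.1)).
  by apply: eq_bigr => k _; rewrite wtZ.
rewrite /reflH /actH /wt raddf_sum; apply: eq_bigr => k _.
rewrite /= comp_mpolyZ; congr (_ *: _); exact: reflH_X.
Qed.

Definition expK l : charring n := 1 - cexp (- l).
Definition expKV l : charring n := 1 - cexp l.

Lemma expK_group_law : group_law 1 expK.
Proof.
rewrite /expK; split=> [|l m]; first by rewrite oppr0 cexp0 subrr.
by rewrite opprD cexpD; ring.
Qed.

Lemma expKV_group_law : group_law 1 expKV.
Proof.
rewrite /expKV; split=> [|l m]; first by rewrite cexp0 subrr.
by rewrite cexpD; ring.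
Qed.

Lemma reflK_exp i l : reflK D i (1 - cexp l) = 1 - cexp (reflmx D i *m l).
Proof.
apply: (addIr (reflK D i (cexp l))); rewrite /reflK -actKD subrK.
by rewrite -[1 in LHS]cexp0 !actK_exp mulmx0 cexp0 subrK.
Qed.

(** The cross relation, rewritten for [1 - x * d]: multiplied by [x], the term [q] is [p - p'] and
    replaces [p] by [p']. *)
Lemma reflection_scal (A : pzRingType) (x p p' q d : A) :
  d * p = q + p' * d -> x * q = p - p' -> x * p' = p' * x ->
  (1 - x * d) * p = p' * (1 - x * d).
Proof.
move=> dp xq xp; reassoc (p - x * (d * p)); rewrite dp.
reassoc (p - x * q - (x * p') * d); rewrite xq xp; ncring.
Qed.

Section Cohomology.
Context (N : nil_hecke D) (HN : nil_hecke_ext N) (T : tensor3 HN N N).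

Lemma r_nil_scal i p : r_nil HN i * nhx_scal HN p = nhx_scal HN (reflH D i p) * r_nil HN i.
Proof.
apply: (reflection_scal (nhx_cross _ i p)); last by rewrite -!rmorphM mulrC.
by rewrite -rmorphM ddiffHE rmorphB.
Qed.

Lemma L_hecke : hecke_family D 0 (L_elt T).
Proof.
pose d i := nhx_incl HN (nh_gen N i).
have dH : hecke_family D 0 d := hecke_rmorph (nhx_incl HN) (nh_hecke N).
have refl : reflects D (@wt n) (nhx_scal HN) (r_nil HN).
  by move=> i l; rewrite r_nil_scal reflH_wt.
have [rsq rbr] := coxeter_of_hecke wt_group_law dH refl.
have reg i : GRing.lreg (nhx_scal HN (wt (root i))).
  by apply: (left_basis_lreg (@nhx_basis _ _ _ _ HN)); exact: mulfI (rootH_neq0 D i).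
(* With the opposite generators in the last two factors, [tensor_hecke] produces [- L_elt]: the last
   term keeps its minus sign since two signs cancel in it. *)
have NH := nil_hecke_opp (nh_hecke N).
have xu i : nhx_scal HN (wt (root i)) * - (d i * r_nil HN i) = 1 - r_nil HN i.
  set x := nhx_scal _ _; have r2 : r_nil HN i * r_nil HN i = 1 by exact: rsq.
  have xd : x * d i = 1 - r_nil HN i by rewrite /r_nil -/(d i) opprB addrC subrK.
  reassoc (- ((x * d i) * r_nil HN i)); rewrite xd.
  by reassoc (- r_nil HN i + r_nil HN i * r_nil HN i); rewrite r2 addrC.
have := nil_hecke_opp (tensor_hecke wt_group_law T (@nh_basis _ _ _ N) (@nh_basis _ _ _ N)
  refl rsq rbr NH NH reg xu).
congr (hecke_family D 0 _); apply/boolp.funext => i.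
rewrite /L_elt -/(d i) !pureE !rmorphN; ncring.
Qed.

End Cohomology.

Section KTheory.
Context (Z : zero_hecke D) (KZ : zero_hecke_ext Z) (T : tensor3 KZ Z Z).
Let d i := zhx_incl KZ (zh_gen Z i).
Let e l := zhx_scal KZ (cexp l).

Let eN l : e l * e (- l) = 1.
Proof. by rewrite -rmorphM -cexpD addrN cexp0 rmorph1. Qed.

Let r_ringE i : r_ring KZ i = 1 - zhx_scal KZ (rootK D i) * d i.
Proof. by rewrite /r_ring rmorphB rmorph1. Qed.

Let r_ring_scal i p :
  r_ring KZ i * zhx_scal KZ p = zhx_scal KZ (reflK D i p) * r_ring KZ i.
Proof.
rewrite r_ringE; apply: (reflection_scal (zhx_cross _ i p)); last by rewrite -!rmorphM mulrC.
by rewrite -rmorphM ddiffKE rmorphB.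
Qed.

Let dH : hecke_family D 1 d := hecke_rmorph (zhx_incl KZ) (zh_hecke Z).

Let refl : reflects D expK (zhx_scal KZ) (r_ring KZ).
Proof. by move=> i l; rewrite r_ring_scal reflK_exp mulmxN. Qed.

Let reflV : reflects D expKV (zhx_scal KZ) (r_ring KZ).
Proof. by move=> i l; rewrite r_ring_scal reflK_exp. Qed.

Let r_ring_coxeter : (forall i, r_ring KZ i * r_ring KZ i = 1) /\ braided D 1 (r_ring KZ).
Proof.
have -> : r_ring KZ = (fun i => 1 - zhx_scal KZ (expK (root i)) * d i).
  by apply/boolp.funext => i; exact: r_ringE.
apply: (coxeter_of_hecke expK_group_law dH) => i l.
by rewrite -[1 - _ * _]r_ringE; exact: refl.
Qed.

(** A consequence of idempotency of [d i]. It reduces the first coefficient of [Lambda_elt] to [d i]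
    and that of [Lambdao_elt] to [- e (- root i) * d i]. *)
Let r_ring_d i : r_ring KZ i * d i = e (- root i) * d i.
Proof.
rewrite r_ringE mulrBl mul1r -mulrA dH.1 /rootK rmorphB rmorph1 mulrBl mul1r.
exact: subKr.
Qed.

Lemma lreg_1Bcexp l : l != 0 -> GRing.lreg (1 - cexp l).
Proof.
move=> l0; apply: mulrI0_lreg => f /eqP; rewrite mulrBl mul1r subr_eq0 => /eqP/esym.
exact: cexp_fix_eq0.
Qed.

Let reg_exp l : l != 0 -> GRing.lreg (zhx_scal KZ (1 - cexp l)).
Proof. by move/lreg_1Bcexp; exact: (left_basis_lreg (@zhx_basis _ _ _ _ KZ)). Qed.

Lemma Lambda_hecke : hecke_family D 1 (Lambda_elt T).
Proof.
have [rsq rbr] := r_ring_coxeter.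
have xu i : zhx_scal KZ (expK (root i)) * (- e (root i) * r_ring KZ i * - d i)
    = 1 - r_ring KZ i.
  rewrite [in RHS]r_ringE subKr mulNr mulrNN -(mulrA (e _)) r_ring_d (mulrA (e _)).
  by rewrite eN mul1r.
have reg i : GRing.lreg (zhx_scal KZ (expK (root i))).
  by apply: reg_exp; rewrite oppr_eq0 sroot_neq0.
have := tensor_hecke expK_group_law T (@zh_basis _ _ _ Z) (@zh_basis _ _ _ Z)
  refl rsq rbr (zh_hecke Z) (zh_hecke Z) reg xu.
congr (hecke_family D 1 _); apply/boolp.funext => i.
by rewrite /Lambda_elt /expK rmorphB rmorph1.
Qed.

(** The factor e^(-alpha) cancels the one in [r_circ], so the underlying involution is again
    [r_ring]. Only the weight becomes 1 - e^alpha, and (1 - e^(-alpha)) e^alpha = -(1 - e^alpha)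
    explains the sign of the last term. *)
Lemma Lambdao_hecke : hecke_family D 1 (Lambdao_elt T).
Proof.
have [rsq rbr] := r_ring_coxeter.
have r_circE i : r_circ KZ i = e (root i) * r_ring KZ i by [].
have eVr i : e (- root i) * r_circ KZ i = r_ring KZ i.
  by rewrite r_circE mulrA -{2}[root i]opprK eN mul1r.
have xu i : zhx_scal KZ (expKV (root i)) * (e (- root i) * r_circ KZ i * - d i)
    = 1 - r_ring KZ i.
  rewrite eVr mulrN r_ring_d [in RHS]r_ringE subKr !rmorphB !rmorph1 -!/(e _).
  by reassoc (e (root i) * e (- root i) * d i - e (- root i) * d i); rewrite eN; ncring.
have reg i : GRing.lreg (zhx_scal KZ (expKV (root i))).
  by apply: reg_exp; exact: sroot_neq0.
have := tensor_hecke expKV_group_law T (@zh_basis _ _ _ Z) (@zh_basis _ _ _ Z)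
  reflV rsq rbr (zh_hecke Z) (zh_hecke Z) reg xu.
congr (hecke_family D 1 _); apply/boolp.funext => i.
have xr : (1 - e (- root i)) * r_circ KZ i
    = - (zhx_scal KZ (expKV (root i)) * r_ring KZ i).
  rewrite mulrBl mul1r eVr r_circE rmorphB rmorph1; ncring.
by rewrite /Lambdao_elt -/(e _) xr eVr !pureE rmorphN !mulNr.
Qed.

End KTheory.
End Instances.

Theorem theorem2 (n : nat) (I : finType) (D : root_datum n I)
    (N : nil_hecke D) (HN : nil_hecke_ext N) (T : tensor3 HN N N)
    (Zr : zero_hecke D) (KZr : zero_hecke_ext Zr) (Tr : tensor3 KZr Zr Zr)
    (Zo : zero_hecke D) (KZo : zero_hecke_ext Zo) (To : tensor3 KZo Zo Zo) :
  let L := L_elt T in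
  let Lambda := Lambda_elt Tr in
  let Lambdao := Lambdao_elt To in
  [/\ forall i : I, [/\ L i ^+ 2 = 0, Lambda i ^+ 2 = Lambda i
                      & Lambdao i ^+ 2 = Lambdao i],
      forall i j : I, orthogonal_roots D i j ->
        [/\ L i * L j = L j * L i, Lambda i * Lambda j = Lambda j * Lambda i
          & Lambdao i * Lambdao j = Lambdao j * Lambdao i],
      (forall i j : I, span_A2 D i j ->
        [/\ L i * L j * L i = L j * L i * L j,
            Lambda i * Lambda j * Lambda i = Lambda j * Lambda i * Lambda j
          & Lambdao i * Lambdao j * Lambdao i
            = Lambdao j * Lambdao i * Lambdao j]) /\
      (forall i j : I, span_B2 D i j ->
        L i * L j * L i * L j = L j * L i * L j * L i)
    & [/\ simply_laced D \/ doubly_laced D ->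
            forall (w : weyl D) (Q Q' : seq I),
              reduced_word w Q -> reduced_word w Q' ->
              \prod_(q <- Q) L q = \prod_(q <- Q') L q,
          simply_laced D ->
            forall (w : weyl D) (Q Q' : seq I),
              reduced_word w Q -> reduced_word w Q' ->
              \prod_(q <- Q) Lambda q = \prod_(q <- Q') Lambda q /\
              \prod_(q <- Q) Lambdao q = \prod_(q <- Q') Lambdao q
        & simply_laced D ->
            forall (w : weyl D) (Q Q' : seq I),
              reduced_word w Q -> demazure D Q' = w ->
              \prod_(q <- Q') Lambda q = \prod_(q <- Q) Lambda q /\
              \prod_(q <- Q') Lambdao q = \prod_(q <- Q) Lambdao q]].
Proof.
move=> L Lambda Lambdao.
have HL : hecke_family D 0 L by exact: L_hecke.
have HK : hecke_family D 1 Lambda by exact: Lambda_hecke.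
have HKo : hecke_family D 1 Lambdao by exact: Lambdao_hecke.
(* From here on only the Hecke relations of the three families matter. *)
clearbody L Lambda Lambdao.
have [Lsq Lbr] := HL; have [Ksq Kbr] := HK; have [Kosq Kobr] := HKo.
split.
- by move=> i; rewrite !expr2 Lsq Ksq Kosq.
- by move=> i j o; rewrite (braid2 Lbr o) (braid2 Kbr o) (braid2 Kobr o).
- split=> i j o; last by rewrite (braid4 Lbr erefl o).
  by rewrite (braid3 Lbr o) (braid3 Kbr o) (braid3 Kobr o).
split.
- move=> laced w Q Q'.
  have dl : doubly_laced D by case: laced => // /simply_doubly.
  apply: (matsumoto dl); apply: (hecke_word_braided HL); by left.
- move=> sl w Q Q' rQ rQ'; have dl := simply_doubly sl.
  split; apply: (matsumoto dl _ rQ rQ').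
    by apply: (hecke_word_braided HK); right.
  by apply: (hecke_word_braided HKo); right.
move=> sl w Q Q' rQ dQ; have dl := simply_doubly sl.
rewrite -dQ in rQ.
split; apply: (demazure_prod dl _ _ rQ) => [|i]; rewrite ?Ksq ?Kosq //.
  by apply: (hecke_word_braided HK); right.
by apply: (hecke_word_braided HKo); right.
Qed.
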